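(* Let $c\colon Q\to G$ be a continuous homomorphism of an $r$-discrete Hausdorff groupoid $Q$ into a discrete group $G$, and put $N=c^{-1}(e)$. Assume that $Q$ is second countable. Then the canonical map $i\colon C^*(N)\to C^*(Q)$ is faithful.
   Context: Groupoids are locally compact topological groupoids. A groupoid $Q$ is $r$-discrete if its range map $r$ is a local homeomorphism onto the unit space $Q^0$ (so counting measures on the sets $Q^u=r^{-1}(u)$ give a Haar system). $C_c(Q)$ is a $^*$-algebra with $(fg)(x)=\sum_{r(y)=r(x)}f(y)g(y^{-1}x)$ and $f^*(x)=\overline{f(x^{-1})}$, and $C^*(Q)$, the full groupoid $C^*$-algebra, is the enveloping $C^*$-algebra of $C_c(Q)$. With $e$ the identity of $G$, $N=c^{-1}(e)$ is an open $r$-discrete subgroupoid of $Q$, and $i\colon C^*(N)\to C^*(Q)$ is the homomorphism extending the inclusion (by zero) of $C_c(N)$ in $C_c(Q)$. *)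

(* Defs.v *)
From HB Require Import structures.
From mathcomp Require Import all_boot all_order all_algebra.
From mathcomp Require Import all_classical all_reals all_analysis.
From mathcomp Require Import complex.

Set Implicit Arguments.
Unset Strict Implicit.
Unset Printing Implicit Defensive.

Import Order.TTheory GRing.Theory Num.Theory.
Import numFieldNormedType.Exports.

Local Open Scope classical_set_scope.
Local Open Scope ring_scope.

(* Topological groupoids, axiomatised by a partial product and an inversion.
   The product is a total function whose values outside [composable] are
   irrelevant: no definition below depends on them. *)
Record groupoid := Groupoid {
  arrow :> topologicalType;
  composable : set (arrow * arrow);
  gmul : arrow -> arrow -> arrow;
  ginv : arrow -> arrow;
  ginvK : involutive ginv;
  gmulA : forall x y z, composable (x, y) -> composable (y, z) ->
    [/\ composable (gmul x y, z), composable (x, gmul y z) &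
        gmul (gmul x y) z = gmul x (gmul y z)];
  composableVg : forall x, composable (ginv x, x);
  composablegV : forall x, composable (x, ginv x);
  gmulKg : forall x y, composable (x, y) -> gmul (ginv x) (gmul x y) = y;
  gmulgK : forall x z, composable (z, x) -> gmul (gmul z x) (ginv x) = z;
  gmul_continuous : {within composable, continuous (fun p => gmul p.1 p.2)};
  ginv_continuous : continuous ginv }.

Arguments composable {g} _.
Arguments gmul {g} _ _.
Arguments ginv {g} _.

Definition grange (Q : groupoid) (x : Q) : Q := gmul x (ginv x).

(* As a type, [units Q] carries the subspace topology. *)
Definition units (Q : groupoid) : set Q := range (@grange Q).

Arguments units : clear implicits.

Definition range_map (Q : groupoid) (x : Q) : units Q :=
  SigSub (mem_set (imageT (@grange Q) x)).

Definition local_homeomorphism (X Y : topologicalType) (f : X -> Y) :=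
  forall x, exists (U : set X) (g : Y -> X),
    [/\ open U, U x & open (f @` U)] /\
    [/\ {within U, continuous f}, {within f @` U, continuous g} &
        {in U, cancel f g}].

Definition r_discrete (Q : groupoid) := local_homeomorphism (@range_map Q).

Arguments r_discrete : clear implicits.

Definition groupoid_hom (Q : groupoid) (G : groupType) (c : Q -> G) :=
  forall x y, composable (x, y) -> c (gmul x y) = (c x * c y)%g.

Lemma continuous_compose (X Y Z : topologicalType) (f : X -> Y) (g : Y -> Z) :
  continuous f -> continuous g -> continuous (fun x => g (f x)).
Proof. by move=> cf cg x; exact: (continuous_comp (cf x) (cg (f x))). Qed.

Lemma continuous_to_sub (X Y : topologicalType) (A : set Y) (f : X -> A) :
  continuous (fun x => val (f x)) -> continuous f.
Proof.
move=> cf; apply/continuousP => _ [W oW <-].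
exact: (proj1 (continuousP _) cf W oW).
Qed.

Lemma val_continuous (Y : topologicalType) (A : set Y) :
  continuous (fun x : A => val x : Y).
Proof. exact: initial_continuous. Qed.

Section Kernel.
Variables (Q : groupoid) (G : groupType) (c : Q -> G).
Hypothesis c_hom : groupoid_hom c.

Definition hom_kernel : set Q := c @^-1` [set 1%g].

Let N : topologicalType := hom_kernel.

Definition ker_composable : set (N * N) :=
  [set p | composable (val p.1, val p.2)].

Definition ker_mul (x y : N) : N := insubd x (gmul (val x) (val y)).

Lemma hom_kernelV (x : Q) : hom_kernel x -> hom_kernel (ginv x).
Proof.
rewrite /hom_kernel /= => cx.
have xV := composablegV x; have Vx := composableVg x.
have [_ VxV _] := gmulA Vx xV.
have := congr1 c (gmulKg xV); rewrite (c_hom VxV) (c_hom xV) cx mul1g.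
by rewrite -[RHS]mulg1 => /mulgI.
Qed.

Definition ker_inv (x : N) : N :=
  SigSub (mem_set (hom_kernelV (set_valP x))).

Lemma val_ker_mul (x y : N) : ker_composable (x, y) ->
  val (ker_mul x y) = gmul (val x) (val y).
Proof.
move=> xy; rewrite val_insubd mem_set //.
by rewrite /hom_kernel /= (c_hom xy) (set_valP x) (set_valP y) mulg1.
Qed.

Lemma ker_invK : involutive ker_inv.
Proof. by move=> x; apply: val_inj; rewrite /= ginvK. Qed.

Lemma ker_mulA (x y z : N) : ker_composable (x, y) -> ker_composable (y, z) ->
  [/\ ker_composable (ker_mul x y, z), ker_composable (x, ker_mul y z) &
      ker_mul (ker_mul x y) z = ker_mul x (ker_mul y z)].
Proof.
move=> xy yz; have [xyz1 xyz2 e] := gmulA xy yz.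
have c1 : ker_composable (ker_mul x y, z).
  by rewrite /ker_composable /= (val_ker_mul xy).
have c2 : ker_composable (x, ker_mul y z).
  by rewrite /ker_composable /= (val_ker_mul yz).
split=> //; apply: val_inj.
by rewrite (val_ker_mul c1) (val_ker_mul c2) (val_ker_mul xy) (val_ker_mul yz).
Qed.

Lemma ker_composableVg (x : N) : ker_composable (ker_inv x, x).
Proof. exact: composableVg. Qed.

Lemma ker_composablegV (x : N) : ker_composable (x, ker_inv x).
Proof. exact: composablegV. Qed.

Lemma ker_mulKg (x y : N) : ker_composable (x, y) ->
  ker_mul (ker_inv x) (ker_mul x y) = y.
Proof.
move=> xy; have [_ Vxy _] := ker_mulA (ker_composableVg x) xy.
by apply: val_inj; rewrite (val_ker_mul Vxy) (val_ker_mul xy) gmulKg.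
Qed.

Lemma ker_mulgK (x z : N) : ker_composable (z, x) ->
  ker_mul (ker_mul z x) (ker_inv x) = z.
Proof.
move=> zx; have [zxV _ _] := ker_mulA zx (ker_composablegV x).
by apply: val_inj; rewrite (val_ker_mul zxV) (val_ker_mul zx) gmulgK.
Qed.

Lemma ker_inv_continuous : continuous ker_inv.
Proof.
apply: continuous_to_sub => x.
apply: (@continuous_comp N Q Q (fun x => val x) ginv).
  exact: val_continuous.
exact: ginv_continuous.
Qed.

Lemma ker_mul_continuous :
  {within ker_composable, continuous (fun p => ker_mul p.1 p.2)}.
Proof.
apply/subspace_sigL_continuousP/continuous_to_sub.
have /subspace_sigL_continuousP cm := @gmul_continuous Q.
pose h (p : ker_composable) : (composable : set (Q * Q)) :=
  SigSub (mem_set (set_valP p) : (val (val p).1, val (val p).2) \in composable).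
have -> : (fun p => val (sigL ker_composable (fun p => ker_mul p.1 p.2) p)) =
          sigL composable (fun p => gmul p.1 p.2) \o h.
  apply/funext => p; rewrite /= -val_ker_mul //.
  by case: p => -[x y] /= /set_mem.
have cv : continuous (fun p : ker_composable => val p).
  exact: val_continuous.
have vN : continuous (fun x : N => val x) by exact: val_continuous.
have cfst : continuous (fun p : N * N => p.1).
  by move=> p; exact: cvg_fst.
have csnd : continuous (fun p : N * N => p.2).
  by move=> p; exact: cvg_snd.
have c1 := continuous_compose (continuous_compose cv cfst) vN.
have c2 := continuous_compose (continuous_compose cv csnd) vN.
have ch : continuous h.
  apply: continuous_to_sub => p.
  exact: (cvg_pair (c1 p) (c2 p)).
exact: (continuous_compose ch cm).
Qed.

Definition kernel_groupoid : groupoid :=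
  Groupoid ker_invK ker_mulA ker_composableVg ker_composablegV
    ker_mulKg ker_mulgK ker_mul_continuous ker_inv_continuous.

End Kernel.

Section ConvolutionAlgebra.
Variables (R : realType) (Q : groupoid).

(* [R[i]^o] is the field [R[i]] with the topology of its modulus. *)
Definition Cc : set (Q -> R[i]^o) :=
  [set f | continuous f /\ compact (closure [set x | f x != 0])].

(* A finite sum for [f] and [g] in [Cc] when [Q] is Hausdorff and r-discrete. *)
Definition convolution (f g : Q -> R[i]^o) : Q -> R[i]^o := fun x =>
  \sum_(y \in [set y | grange y = grange x]) (f y * g (gmul (ginv y) x)).

Definition invol (f : Q -> R[i]^o) : Q -> R[i]^o := fun x => (f (ginv x))^*.

End ConvolutionAlgebra.

Arguments Cc : clear implicits.

(* Not necessarily unital. *)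
Record cstarAlgebra (R : realType) := CStarAlgebra {
  cstar_car :> completeNormedModType R[i];
  cmul : cstar_car -> cstar_car -> cstar_car;
  cstar : cstar_car -> cstar_car;
  cmulA : associative cmul;
  cmul_linearl : forall (l : R[i]) a b d,
    cmul (l *: a + b) d = l *: cmul a d + cmul b d;
  cmul_linearr : forall (l : R[i]) a b d,
    cmul a (l *: b + d) = l *: cmul a b + cmul a d;
  cstarK : involutive cstar;
  cstar_antilinear : forall (l : R[i]) a b,
    cstar (l *: a + b) = l^* *: cstar a + cstar b;
  cstarM : forall a b, cstar (cmul a b) = cmul (cstar b) (cstar a);
  cnormM : forall a b, `|cmul a b| <= `|a| * `|b|;
  cnorm_star : forall a, `|cmul (cstar a) a| = `|a| ^+ 2 }.

Arguments cmul {R c} _ _.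
Arguments cstar {R c} _.

Record hilbert (R : realType) := Hilbert {
  hilbert_car :> completeNormedModType R[i];
  inner : hilbert_car -> hilbert_car -> R[i];
  inner_linear : forall (l : R[i]) x y z,
    inner (l *: x + y) z = l * inner x z + inner y z;
  innerC : forall x y, inner y x = (inner x y)^*;
  inner_norm : forall x, inner x x = `|x| ^+ 2 }.

Arguments inner {R h} _ _.

(* The library's norm takes values in the scalar field [R[i]]. *)
Definition rnorm (R : realType) (V : normedModType R[i]) (v : V) : R :=
  complex.Re `|v|.

Definition opnorm (R : realType) (V W : normedModType R[i]) (T : V -> W) :
    \bar R :=
  ereal_sup [set (rnorm (T v))%:E | v in [set v | rnorm v <= 1]].

Section Representations.
Variables (R : realType) (Q : groupoid).
Local Notation CcQ := (Cc R Q).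

(* *-homomorphisms out of [C_c(Q)] are encoded by functions on all of
   [Q -> R[i]^o] whose values outside [C_c(Q)] are irrelevant. *)

Record Cc_rep (H : hilbert R) (pi : (Q -> R[i]^o) -> H -> H) : Prop := {
  rep_linear_op : forall f, CcQ f -> linear (pi f);
  rep_bounded_op : forall f, CcQ f -> (opnorm (pi f) < +oo)%E;
  rep_linear : forall (l : R[i]) f g, CcQ f -> CcQ g -> forall xi,
    pi (fun x => l * f x + g x) xi = l *: pi f xi + pi g xi;
  rep_conv : forall f g, CcQ f -> CcQ g -> forall xi,
    pi (convolution f g) xi = pi f (pi g xi);
  rep_invol : forall f, CcQ f -> forall xi eta,
    inner (pi f xi) eta = inner xi (pi (invol f) eta) }.

Record Cc_hom (A : cstarAlgebra R) (phi : (Q -> R[i]^o) -> A) : Prop := {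
  Cc_hom_linear : forall (l : R[i]) f g, CcQ f -> CcQ g ->
    phi (fun x => l * f x + g x) = l *: phi f + phi g;
  Cc_hom_conv : forall f g, CcQ f -> CcQ g ->
    phi (convolution f g) = cmul (phi f) (phi g);
  Cc_hom_invol : forall f, CcQ f -> phi (invol f) = cstar (phi f) }.

Definition rep_norms (f : Q -> R[i]^o) : set \bar R :=
  [set t | exists (H : hilbert R) (pi : (Q -> R[i]^o) -> H -> H),
    Cc_rep pi /\ t = opnorm (pi f)].

(* [(A, iota)] is the enveloping C*-algebra of [C_c(Q)], that is, its Hausdorff
   completion for the seminorm sup_pi ||pi(f)||, where pi ranges over the
   *-representations by bounded operators on Hilbert spaces.  This determines
   [(A, iota)] up to a unique isomorphism. *)
Record groupoid_Cstar (A : cstarAlgebra R) (iota : (Q -> R[i]^o) -> A) :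
    Prop := {
  Cstar_hom : Cc_hom iota;
  Cstar_dense : closure (iota @` CcQ) = setT;
  Cstar_norm : forall f, CcQ f ->
    (rnorm (iota f))%:E = ereal_sup (rep_norms f) }.

End Representations.

Record cstar_hom (R : realType) (A B : cstarAlgebra R) (phi : A -> B) :
    Prop := {
  cstar_hom_linear : linear phi;
  cstar_hom_mul : forall a b, phi (cmul a b) = cmul (phi a) (phi b);
  cstar_hom_star : forall a, phi (cstar a) = cstar (phi a);
  (* automatic for *-homomorphisms of C*-algebras *)
  cstar_hom_continuous : continuous phi }.

(* [valL_ 0 f] is the extension of [f] by zero. *)
Definition canonical_map (R : realType) (Q : groupoid) (G : groupType)
    (c : Q -> G) (c_hom : groupoid_hom c) (A B : cstarAlgebra R)
    (iotaN : (kernel_groupoid c_hom -> R[i]^o) -> A)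
    (iotaQ : (Q -> R[i]^o) -> B) (i : A -> B) :=
  cstar_hom i /\
  forall f, Cc R (kernel_groupoid c_hom) f -> i (iotaN f) = iotaQ (valL_ 0 f).

(* Main.v *)
(** The canonical map is isometric, and the point is that every representation
    [pi] of [C_c(N)] is dominated by one of [C_c(Q)]. For a vector [xi], put
    [<k, l> = (pi ((l^* k)|_N) xi, xi)] on [C_c(Q)]. By a partition argument any
    [k] in [C_c(Q)] satisfies [(k^* k)|_N = sum_j b_j^* b_j] with [b_j] in
    [C_c(N)]: cover the support of [k] by the inverses of open sets on which the
    range map is injective and [c] is constant, take functions [h_j] supported
    there, and note that [h_j^* h_j] is supported on the units, so that
    [k'^* (sum_j h_j^* h_j) k'] recovers [k^* k] for a suitable multiple [k'] of
    [k]. Hence the form is positive, left multiplication by [C_c(Q)] is bounded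
    for it, and its completion carries a representation [rho] with
    [|pi(f) pi(g) xi| <= |rho(f)| |pi(g) xi|]. Taking [g = f^*] gives
    [|pi(f)| <= |f|_Q]. *)

Require Import Defs.
From HB Require Import structures.
From mathcomp Require Import all_boot all_order all_algebra.
From mathcomp Require Import all_classical all_reals all_analysis.
From mathcomp Require Import complex.
From mathcomp Require Import ring.

Set Implicit Arguments.
Unset Strict Implicit.
Unset Printing Implicit Defensive.

Import Order.TTheory GRing.Theory Num.Theory.
Import numFieldNormedType.Exports.

Local Open Scope classical_set_scope.
Local Open Scope ring_scope.

(** * Limits of complex sequences *)

(** Restriction to [N] acts as a conditional expectation, and the obstacle is its positivity. If
    [k_g] is the part of [k] of degree [g], then the degree-one part of [k^* k] is the sum of the
    [k_g^* k_g]; but [k_g] lives over degree [g], where [pi] is not defined. Multiplying on the left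
    by a function of degree [g^-1] moves it into [N]. A global section of that degree need not
    exist, so local bumps [h_j] are used, and the [h_j^* h_j] add up to a weight [E] that is not
    constant. This weight depends only on range and degree, and functions of that kind move across
    the inner product. So [k' = k / sqrt E] absorbs the weight exactly, without any approximation.

    The estimate by [|rho(f)|] is obtained only on vectors [pi(g) xi]: these come from elements of
    [C_c(N)], while [xi] itself would have to come from a unit. With [g = f^*] it bounds [pi(f)] on
    the range of its adjoint, and [adjoint_bound] turns this into a bound everywhere. *)

Lemma invSn_small (R : realType) (e : R[i]) : 0 < e -> exists n : nat, n.+1%:R^-1 < e.
Proof.
case: e => a b; rewrite ltcE /= => /andP[/eqP -> a0].
have /archi_boundP := ltW (divr_gt0 ltr01 a0) => /=.
set n := Num.Def.archi_bound _ => an.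
exists n; rewrite -[n.+1%:R]/((n.+1%:R : R[i])).
have -> : (n.+1%:R^-1 : R[i]) = (n.+1%:R^-1 : R)%:C%C.
  by rewrite fmorphV /= rmorph_nat.
rewrite ltcR -[ltRHS]invrK ltf_pV2 ?posrE ?invr_gt0 ?ltr0n //.
by rewrite -[_^-1]div1r (lt_le_trans an) // ler_nat.
Qed.

Lemma ler_mul_addgt0 (F : numFieldType) (x y K : F) : 0 <= K ->
  (forall e, 0 < e -> x <= y + K * e) -> x <= y.
Proof.
move=> K0 h; apply/ler_addgt0Pr => e e0.
have K1 : 0 < K + 1 by rewrite ltr_wpDl.
apply: le_trans (h (e / (K + 1)) (divr_gt0 e0 K1)) _.
rewrite lerD2l mulrA ler_pdivrMr // mulrC ler_pM2l //.
by rewrite lerDl.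
Qed.

(** The cap [e <= 1] allows error terms quadratic in [e], which arise from products of
    approximations, to be absorbed into a linear one. *)
Lemma ler_mul_addgt0_le1 (F : numFieldType) (x y K : F) : 0 <= K ->
  (forall e, 0 < e -> e <= 1 -> x <= y + K * e) -> x <= y.
Proof.
move=> K0 h; apply: (ler_mul_addgt0 K0) => e e0.
have e_r : e >=< 1 by rewrite real_comparable ?gtr0_real.
have [e1|e1] := comparable_leP e_r; first exact: h.
apply: le_trans (h 1 ltr01 (lexx _)) _.
by rewrite lerD2l ler_wpM2l // ltW.
Qed.

Lemma norm_le_small0 (F : numFieldType) (V : normedZmodType F) (x : V) (K : F) :
  0 <= K -> (forall e, 0 < e -> e <= 1 -> `|x| <= K * e) -> x = 0.
Proof.
move=> K0 h; apply/eqP; rewrite -normr_le0.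
by apply: (ler_mul_addgt0_le1 K0) => e e0 e1; rewrite add0r h.
Qed.

Lemma real_seq_cauchy_limit (R : realType) (u : nat -> R) :
  (forall n m, `|u n - u m| <= n.+1%:R^-1 + m.+1%:R^-1) ->
  exists l, forall n, `|u n - l| <= n.+1%:R^-1.
Proof.
move=> h.
have inv0 : n.+1%:R^-1 @[n --> \oo] --> (0 : R) by exact: cvg_harmonic.
have /cvg_ex[l ul] : cvg (u @ \oo).
  apply/cauchy_cvgP; apply: cauchy_exP => e e0.
  have e2 : 0 < e / 2 by exact: divr_gt0.
  have [N _ hN] := cvgr_lt _ inv0 _ e2.
  exists (u N), N => // m Nm; rewrite /= -ball_normE /=.
  apply: le_lt_trans (h _ _) _; rewrite [e]splitr ltrD ?hN //=.
exists l => n.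
have c1 : `|u n - u m| @[m --> \oo] --> `|u n - l|.
  by apply: cvg_norm; apply: cvgB => //; exact: cvg_cst.
have c2 : n.+1%:R^-1 + m.+1%:R^-1 @[m --> \oo] --> n.+1%:R^-1 + (0 : R).
  by apply: cvgD => //; exact: cvg_cst.
rewrite -[leRHS]addr0.
by apply: (ler_cvg_to c1 c2); apply: nearW => m; exact: h.
Unshelve. all: by end_near. Qed.

Lemma normci (R : realType) : `|'i%C| = 1 :> R[i].
Proof. by rewrite normc_def /= expr0n expr1n add0r sqrtr1. Qed.

Lemma normc_real (R : realType) (r : R) : `|r%:C%C| = `|r|%:C%C.
Proof. by rewrite normc_def /= expr0n addr0 sqrtr_sqr. Qed.

Lemma invSn_real (R : realType) n : (n.+1%:R^-1 : R[i]) = (n.+1%:R^-1 : R)%:C%C.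
Proof. by rewrite fmorphV /= rmorph_nat. Qed.

(** After division by [K] the real and imaginary parts fall under the real case; adding their two
    errors gives the factor [2]. *)
Lemma complex_seq_cauchy_limit (R : realType) (u : nat -> R[i]) (K : R[i]) :
  0 < K ->
  (forall n m, `|u n - u m| <= K * (n.+1%:R^-1 + m.+1%:R^-1)) ->
  exists l, forall n, `|u n - l| <= 2 * K * n.+1%:R^-1.
Proof.
move=> K0 h.
have tor n m : `|(u n - u m) / K| <= (n.+1%:R^-1 + m.+1%:R^-1 : R)%:C%C.
  rewrite normrM normfV (gtr0_norm K0) ler_pdivrMr // mulrC.
  by rewrite rmorphD /= !fmorphV /= !rmorph_nat.
have [a ha] : exists l, forall n, `|complex.Re (u n / K) - l| <= n.+1%:R^-1.
  apply: real_seq_cauchy_limit => n m; rewrite -lecR.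
  by apply: le_trans (tor n m); rewrite mulrBl -raddfB; exact: normc_ge_Re.
have [b hb] : exists l, forall n, `|complex.Im (u n / K) - l| <= n.+1%:R^-1.
  apply: real_seq_cauchy_limit => n m; rewrite -lecR.
  apply: le_trans (tor n m); rewrite mulrBl.
  (* Since [Im z = - Re (z 'i)], the bound of a real part by the modulus also serves for the
     imaginary part. *)
  rewrite (_ : complex.Im _ - complex.Im _ = - complex.Re ((u n / K - u m / K) * 'i%C)).
    rewrite normrN; apply: le_trans (normc_ge_Re _) _.
    by rewrite normrM normci mulr1.
  by rewrite ReiNIm opprK; case: (u n / K) => ? ?; case: (u m / K).
exists (K * (a +i* b)%C) => n.
have -> : u n - K * (a +i* b)%C = K * (u n / K - (a +i* b)%C).
  by rewrite mulrBr [K * (_ / _)]mulrC divfK // gt_eqF.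
rewrite normrM (gtr0_norm K0) [2 * K]mulrC -mulrA ler_pM2l //.
set z := u n / K.
have -> : z - (a +i* b)%C = (complex.Re z - a)%:C%C + 'i%C * (complex.Im z - b)%:C%C.
  by rewrite [LHS]complexE !raddfB.
apply: le_trans (ler_normD _ _) _; rewrite normrM normci.
rewrite mul1r mulr2n mulrDl mul1r.
by rewrite !normc_real invSn_real lerD // lecR; [exact: ha|exact: hb].
Qed.

(** * Semi-inner products and their completion *)

(* The carrier need not be a module: only the form matters, and vectors are
   identified when the form cannot tell them apart. *)
Record prehilbert (R : realType) := Prehilbert {
  pre_car :> Type;
  pre_point : pre_car;
  pre_lin : R[i] -> pre_car -> pre_car -> pre_car;
  dot : pre_car -> pre_car -> R[i];
  dot_linear : forall (l : R[i]) x y z,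
    dot (pre_lin l x y) z = l * dot x z + dot y z;
  dotC : forall x y, dot y x = (dot x y)^*;
  dot_ge0 : forall x, 0 <= dot x x }.

Arguments pre_lin {R p} _ _ _.
Arguments dot {R p} _ _.
Arguments pre_point {R} _.

Section Prehilbert.
Variables (R : realType) (X : prehilbert R).
Implicit Types (x y z : X) (l : R[i]).

Definition dnorm x : R[i] := sqrtC (dot x x).

Lemma dnorm_ge0 x : 0 <= dnorm x.
Proof. by rewrite sqrtC_ge0 dot_ge0. Qed.

Lemma dnormK x : dnorm x ^+ 2 = dot x x.
Proof. exact: sqrtCK. Qed.

Lemma dot_linearr l x y z : dot z (pre_lin l x y) = l^* * dot z x + dot z y.
Proof. by rewrite dotC dot_linear rmorphD rmorphM /= -!dotC. Qed.

Lemma dot_cauchy_schwarz x y : `|dot x y| <= dnorm x * dnorm y.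
Proof.
rewrite -ler_sqr ?nnegrE ?mulr_ge0 ?dnorm_ge0 // exprMn !dnormK.
set a := dot x y; set b := dot y y; set d := dot x x.
have b0 : 0 <= b by exact: dot_ge0.
have d0 : 0 <= d by exact: dot_ge0.
(* This is positivity of the form at [x - s a y]. If [b] is nonzero, [s = b^-1] minimises the
   quadratic; if [b = 0] and [a] is nonzero, the value of [s] chosen below makes it equal to
   [-1]. *)
have key (s : R[i]) : 0 <= s -> 0 <= d - 2 * s * `|a| ^+ 2 + s ^+ 2 * `|a| ^+ 2 * b.
  move=> s0; have := dot_ge0 (pre_lin (- s * a) y x).
  rewrite dot_linear !dot_linearr -/b -/d (dotC x y) -/a.
  rewrite rmorphM rmorphN /= (conj_Creal (ger0_real s0)) normCK.
  by congr (_ <= _); ring.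
have [b00|bn0] := eqVneq b 0.
  have [->|an0] := eqVneq a 0; first by rewrite normr0 expr0n b00 mulr0.
  have a0 : 0 < `|a| ^+ 2 by rewrite exprn_gt0 // normr_gt0.
  have s0 : 0 <= (d + 1) / (2 * `|a| ^+ 2).
    by rewrite divr_ge0 ?addr_ge0 ?mulr_ge0 // ltW.
  have := key _ s0; rewrite b00 mulr0 addr0.
  have -> : 2 * ((d + 1) / (2 * `|a| ^+ 2)) * `|a| ^+ 2 = d + 1.
    by set A := `|a| ^+ 2 in a0 *; field; rewrite (gt_eqF a0) .
  by rewrite opprD addrA subrr add0r oppr_ge0 ler10.
have bgt : 0 < b by rewrite lt0r bn0.
have := key b^-1; rewrite invr_ge0 b0 => /(_ isT).
have -> : d - 2 / b * `|a| ^+ 2 + b^-1 ^+ 2 * `|a| ^+ 2 * b = d - `|a| ^+ 2 / b.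
  by field.
by rewrite subr_ge0 ler_pdivrMr.
Qed.

Lemma dnormZD l x y : dnorm (pre_lin l x y) <= `|l| * dnorm x + dnorm y.
Proof.
have p0 : 0 <= `|l| * dnorm x + dnorm y.
  by rewrite addr_ge0 ?mulr_ge0 ?dnorm_ge0.
rewrite -ler_sqr ?nnegrE ?dnorm_ge0 // dnormK -[leLHS]ger0_norm ?dot_ge0 //.
rewrite dot_linear !dot_linearr mulrDr.
rewrite (_ : (_ + _) ^+ 2 = (`|l| * `|l| * dnorm x ^+ 2 +
  `|l| * (dnorm x * dnorm y)) + (`|l| * (dnorm x * dnorm y) + dnorm y ^+ 2)); last by ring.
have lxy : `|l * dot x y| <= `|l| * (dnorm x * dnorm y).
  by rewrite normrM ler_wpM2l // dot_cauchy_schwarz.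
apply: le_trans (ler_normD _ _) _; apply: lerD.
  apply: le_trans (ler_normD _ _) _; apply: lerD => //.
  by rewrite !normrM norm_conjC mulrA dnormK (ger0_norm (dot_ge0 x)).
apply: le_trans (ler_normD _ _) _; apply: lerD.
  by rewrite dotC normrM !norm_conjC -normrM.
by rewrite dnormK (ger0_norm (dot_ge0 y)).
Qed.

Lemma dnorm_dual x (e : R[i]) : 0 <= e ->
  (forall y, `|dot x y| <= e * dnorm y) -> dnorm x <= e.
Proof.
move=> e0 /(_ x); rewrite (ger0_norm (dot_ge0 x)) -dnormK expr2.
have := dnorm_ge0 x; rewrite le0r => /predU1P[->|x0]; first by [].
by rewrite ler_pM2r.
Qed.

End Prehilbert.

Section Completion.
Variables (R : realType) (X : prehilbert R).
Local Notation K := R[i].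
Implicit Types (F G : X -> K) (v w x : X) (e d k l : K).

(* [F] is within [e], in the dual norm, of the functional [dot v _]. *)
Definition approx F v e := forall x, `|F x - dot v x| <= e * dnorm x.

Lemma approx_dot v : approx (dot v) v 0.
Proof. by move=> x; rewrite subrr normr0 mul0r. Qed.

Lemma approx_lin l F G v w e d : approx F v e -> approx G w d ->
  approx (fun x => l * F x + G x) (pre_lin l v w) (`|l| * e + d).
Proof.
move=> Fv Gw x; rewrite /= dot_linear.
rewrite (_ : _ - _ = l * (F x - dot v x) + (G x - dot w x)); last by ring.
apply: le_trans (ler_normD _ _) _; rewrite mulrDl lerD //.
by rewrite normrM -mulrA ler_wpM2l.
Qed.

Lemma approx_dist F v w e d : 0 <= e -> 0 <= d -> approx F v e -> approx F w d ->
  dnorm (pre_lin (-1) w v) <= e + d.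
Proof.
move=> e0 d0 Fv Fw; apply: dnorm_dual => [|x]; first exact: addr_ge0.
rewrite dot_linear (_ : -1 * _ + _ = (F x - dot w x) - (F x - dot v x)); last by ring.
apply: le_trans (ler_normB _ _) _.
by rewrite addrC mulrDl lerD.
Qed.

Lemma approx_bound F v e x : 0 <= e -> approx F v e ->
  `|F x| <= (dnorm v + e) * dnorm x.
Proof.
move=> e0 Fv; rewrite -[F x](subrK (dot v x)).
apply: le_trans (ler_normD _ _) _; rewrite mulrDl addrC lerD //.
exact: dot_cauchy_schwarz.
Qed.

Definition completion_pred : {pred (X -> K^o)} :=
  [pred F | `[< forall e, 0 < e -> exists v, approx F v e >]].

Lemma completion_submod_closed : submod_closed completion_pred.
Proof.
split=> [|l F G /asboolP Fc /asboolP Gc]; apply/asboolP => e e0.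
  exists (pre_lin (-1) (pre_point X) (pre_point X)) => x.
  rewrite dot_linear mulN1r addNr subr0 -[0 x]/0 normr0.
  by rewrite mulr_ge0 ?dnorm_ge0 ?ltW.
have l1 : 0 < `|l| + 1 by rewrite ltr_wpDl.
have e2 : 0 < e / (`|l| + 1) by rewrite divr_gt0.
have [v Fv] := Fc _ e2; have [w Gw] := Gc _ e2.
exists (pre_lin l v w) => x; apply: le_trans (approx_lin l Fv Gw x) _.
have e1 : e = `|l| * (e / (`|l| + 1)) + e / (`|l| + 1).
  by field; rewrite gt_eqF.
by rewrite -e1.
Qed.

HB.instance Definition _ :=
  GRing.isSubmodClosed.Build K (X -> K^o) completion_pred completion_submod_closed.

(* An element of the completion is a functional that is a limit, in the dual
   norm, of functionals [dot v _]; no quotient of Cauchy sequences is needed, and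
   an operator with adjoint [S] acts by precomposition with [S]. *)
Record completion := Completion {
  functional : X -> K^o;
  functionalP : functional \in completion_pred }.

Definition apply_completion (f : completion) : X -> K := functional f.
Coercion apply_completion : completion >-> Funclass.

HB.instance Definition _ := [isSub for functional].
HB.instance Definition _ := [Choice of completion by <:].
HB.instance Definition _ := [SubChoice_isSubLmodule of completion by <:].

Implicit Types (f g h : completion).

Lemma completion_approx f e : 0 < e -> exists v, approx f v e.
Proof. by move=> e0; have /asboolP := functionalP f; exact. Qed.

Lemma completion_linE l f g x : (l *: f + g) x = l * f x + g x.
Proof. by []. Qed.

Lemma completionP f g : (forall x, f x = g x) -> f = g.
Proof. by move=> fg; apply: val_inj; apply/funext. Qed.

Definition embed v : completion.
Proof.
apply: (@Completion (dot v)); apply/asboolP => e e0; exists v => x.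
by rewrite subrr normr0 mulr_ge0 ?dnorm_ge0 ?ltW.
Defined.

Lemma completion_semilinear f l x y :
  f (pre_lin l x y) = l^* * f x + f y.
Proof.
pose k := dnorm (pre_lin l x y) + `|l| * dnorm x + dnorm y.
have k0 : 0 <= k by rewrite !addr_ge0 ?mulr_ge0 ?dnorm_ge0.
apply/eqP; rewrite -subr_eq0; apply/eqP; apply: (norm_le_small0 k0) => e e0 _.
have [v fv] := completion_approx f e0.
rewrite (_ : _ - _ = (f (pre_lin l x y) - dot v (pre_lin l x y)) -
  l^* * (f x - dot v x) - (f y - dot v y)); last by rewrite dot_linearr; ring.
apply: le_trans (ler_normB _ _) _.
rewrite (_ : k * e = e * dnorm (pre_lin l x y) + e * (`|l| * dnorm x) + e * dnorm y);
  last by rewrite /k; ring.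
apply: lerD => //.
apply: le_trans (ler_normB _ _) _; apply: lerD => //.
by rewrite normrM norm_conjC mulrCA ler_wpM2l.
Qed.

Lemma completion_bounded f : exists2 k, 0 <= k &
  forall x, `|f x| <= k * dnorm x.
Proof.
have [v fv] := completion_approx f ltr01.
exists (dnorm v + 1); first by rewrite addr_ge0 ?dnorm_ge0.
by move=> x; exact: (approx_bound x ler01 fv).
Qed.

(* The value at [w] of [f] converges to [z] as [dot w _] converges to [g]. *)
Definition is_inn f g z := exists2 k, 0 <= k &
  forall w e, 0 <= e -> approx g w e -> `|f w - z| <= k * e.

Lemma is_inn_unique f g z z' : is_inn f g z -> is_inn f g z' -> z = z'.
Proof.
move=> [k k0 fk] [k' k0' fk']; apply/eqP; rewrite -subr_eq0; apply/eqP.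
apply: (@norm_le_small0 _ _ _ (k + k')) => [|e e0 _]; first exact: addr_ge0.
have [w gw] := completion_approx g e0.
rewrite (_ : z - z' = (f w - z') - (f w - z)); last by ring.
apply: le_trans (ler_normB _ _) _.
by rewrite addrC mulrDl lerD ?fk ?fk' // ltW.
Qed.

(** A bounded [f] sends approximants of [g] to a Cauchy sequence with explicit rate. The limit is
    compared with every other approximant through [approx_dist]. *)
Lemma is_inn_exists f g : exists z, is_inn f g z.
Proof.
have [k k0 fk] := completion_bounded f.
have k1 : 0 < k + 1 by rewrite ltr_wpDl.
have iv n : 0 < n.+1%:R^-1 :> K by rewrite invr_gt0 ltr0n.
have [w gw] := choice (fun n => completion_approx g (iv n)).
have dist v v' e d : 0 <= e -> 0 <= d -> approx g v e -> approx g v' d ->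
    `|f v - f v'| <= (k + 1) * (e + d).
  move=> e0 d0 gv gv'.
  have -> : f v - f v' = f (pre_lin (-1) v' v).
    by rewrite completion_semilinear rmorphN rmorph1 mulN1r addrC.
  apply: le_trans (fk _) _; apply: ler_pM (dnorm_ge0 _) _ _ => //.
    by rewrite lerDl.
  exact: approx_dist gv gv'.
have [z fz] : exists l, forall n, `|f (w n) - l| <= 2 * (k + 1) * n.+1%:R^-1.
  by apply: complex_seq_cauchy_limit => // n m; apply: dist; rewrite // ltW.
exists z, (k + 1) => [|v e e0 gv]; first exact: ltW.
(* One [k + 1] comes from comparing [v] with [w n], two from the rate of convergence in [fz]. *)
apply: (@ler_mul_addgt0 _ _ _ (3 * (k + 1))) => [|d d0].
  by rewrite mulr_ge0 // ltW.
have [n nd] := invSn_small d0.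
rewrite (_ : f v - z = (f v - f (w n)) + (f (w n) - z)); last by ring.
apply: le_trans (ler_normD _ _) _.
apply: le_trans (lerD (dist _ _ _ _ e0 (ltW (iv n)) gv (gw n)) (fz n)) _.
rewrite mulrDr -addrA lerD2l -[2 * _ * _]mulrA -[3 * _ * _]mulrA.
rewrite (_ : _ + _ = 3 * ((k + 1) * n.+1%:R^-1)); last by ring.
by rewrite ler_pM2l // ler_pM2l // ltW.
Qed.

Definition inn f g : K := projT1 (cid (is_inn_exists f g)).

Lemma innP f g : is_inn f g (inn f g).
Proof. exact: (projT2 (cid (is_inn_exists f g))). Qed.

Lemma inn_linear l f g h : inn (l *: f + g) h = l * inn f h + inn g h.
Proof.
apply: is_inn_unique (innP _ _) _.
have [a a0 fa] := innP f h; have [b b0 gb] := innP g h.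
exists (`|l| * a + b) => [|w e e0 hw]; first by rewrite addr_ge0 ?mulr_ge0.
rewrite completion_linE.
rewrite (_ : _ - _ = l * (f w - inn f h) + (g w - inn g h)); last by ring.
apply: le_trans (ler_normD _ _) _; rewrite mulrDl lerD ?gb //.
by rewrite normrM -mulrA ler_wpM2l // fa.
Qed.

Lemma innC f g : inn g f = (inn f g)^*.
Proof.
apply: is_inn_unique (innP _ _) _.
have [k k0 fk] := innP f g.
have [w0 gw0] := completion_approx g ltr01.
exists (dnorm w0 + 1) => [|v e e0 fv]; first by rewrite addr_ge0 ?dnorm_ge0.
apply: (@ler_mul_addgt0 _ _ _ (dnorm v + e + k)) => [|d d0].
  by rewrite !addr_ge0 ?dnorm_ge0.
have [w gw] := completion_approx g d0; have d0' := ltW d0.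
(* The constant in [is_inn] may not depend on [v] or [e]. The approximant [w] varies with [d], so
   its norm is controlled through the fixed [w0]. *)
have dw : dnorm w <= dnorm w0 + 1 + d.
  have h := approx_dist d0' ler01 gw gw0.
  have -> : dnorm w = dnorm (pre_lin 1 (pre_lin (-1) w0 w) w0).
    congr sqrtC; rewrite !dot_linear !dot_linearr !(rmorphN, rmorph1) /=.
    by ring.
  apply: le_trans (dnormZD _ _ _) _; rewrite normr1 mul1r.
  by rewrite addrC -addrA lerD2l addrC.
rewrite (_ : _ - _ = (g v - dot w v) - ((f w - dot v w) - (f w - inn f g))^*); last first.
  by rewrite !rmorphB /= (dotC v w); ring.
apply: le_trans (ler_normB _ _) _; rewrite norm_conjC.
apply: le_trans (lerD (gw v) (ler_normB _ _)) _.
apply: le_trans (lerD (lexx _) (lerD (fv w) (fk w d d0' gw))) _.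
apply: le_trans (lerD (lexx _) (lerD (ler_wpM2l e0 dw) (lexx _))) _.
by rewrite le_eqVlt; apply/orP; left; apply/eqP; ring.
Qed.

Lemma inn_embed f v : inn f (embed v) = f v.
Proof.
have [k k0 fk] := innP f (embed v).
apply/eqP; rewrite eq_sym -subr_eq0 -normr_le0.
by have := fk v 0 (lexx _) (approx_dot v); rewrite mulr0.
Qed.

Lemma approx_dnorm_le f v k e : 0 <= k -> 0 <= e ->
  (forall x, `|f x| <= k * dnorm x) -> approx f v e -> dnorm v <= k + e.
Proof.
move=> k0 e0 fk fv; apply: dnorm_dual => [|x]; first exact: addr_ge0.
rewrite (_ : dot v x = f x - (f x - dot v x)); last by ring.
by apply: le_trans (ler_normB _ _) _; rewrite mulrDl lerD.
Qed.

Lemma inn_ge0 f : 0 <= inn f f.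
Proof.
have [k k0 fk] := innP f f; have [b b0 fb] := completion_bounded f.
have zr : inn f f \is Num.real by apply/CrealP; rewrite -innC.
apply: (@ler_mul_addgt0_le1 _ _ _ (k + b + 1)) => [|e e0 e1]; first by rewrite !addr_ge0.
have [v fv] := completion_approx f e0.
have v0 := ltW e0; have vb := approx_dnorm_le b0 v0 fb fv.
have d : `|dot v v - inn f f| <= (k + b + 1) * e.
  rewrite (_ : dot v v - inn f f = (f v - inn f f) - (f v - dot v v)); last by ring.
  apply: le_trans (ler_normB _ _) _.
  apply: le_trans (lerD (fk v e v0 fv) (fv v)) _.
  rewrite -addrA [leRHS]mulrDl lerD2l mulrC ler_wpM2r //.
  by apply: le_trans vb _; rewrite lerD2l.
apply: le_trans (dot_ge0 v) _; rewrite addrC -lerBlDr.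
apply: le_trans d; apply: real_ler_norm.
by rewrite rpredB // ger0_real // dot_ge0.
Qed.

(** Seen as a [prehilbert], the completion inherits Cauchy-Schwarz and the triangle inequality from
    the previous section. *)
Definition completion_prehilbert : prehilbert R :=
  @Prehilbert R completion 0 (fun l f g => l *: f + g) inn inn_linear innC inn_ge0.

Definition completion_norm (f : completion) : K := @dnorm R completion_prehilbert f.

Lemma completion_norm_embed v : completion_norm (embed v) = dnorm v.
Proof. by congr sqrtC; exact: (inn_embed (embed v) v). Qed.

Lemma completion_norm_apply f x : `|f x| <= completion_norm f * dnorm x.
Proof.
rewrite -inn_embed -(completion_norm_embed x).
exact: (@dot_cauchy_schwarz R completion_prehilbert).
Qed.

(** With [completion_norm_apply], this identifies the norm of the inner product with the dual norm,
    in which limits are easier to take. *)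
Lemma completion_norm_le f e : 0 <= e ->
  (forall x, `|f x| <= e * dnorm x) -> completion_norm f <= e.
Proof.
move=> e0 fe; have n0 : 0 <= completion_norm f by exact: dnorm_ge0.
rewrite -ler_sqr ?nnegrE // [leLHS]dnormK /= -[leLHS]ger0_norm ?inn_ge0 //.
have [k k0 fk] := innP f f.
apply: (@ler_mul_addgt0 _ _ _ (e + k)) => [|d d0]; first exact: addr_ge0.
have [w fw] := completion_approx f d0; have d0' := ltW d0.
rewrite (_ : inn f f = f w - (f w - inn f f)); last by ring.
apply: le_trans (ler_normB _ _) _.
apply: le_trans (lerD (fe w) (fk w d d0' fw)) _.
rewrite [in leRHS]mulrDl addrA lerD2r expr2 -mulrDr ler_wpM2l //.
exact: approx_dnorm_le fe fw.
Qed.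

Lemma completion_normD f g :
  completion_norm (f + g) <= completion_norm f + completion_norm g.
Proof.
have := @dnormZD R completion_prehilbert 1 f g.
by rewrite /= scale1r normr1 mul1r.
Qed.

Lemma completion_normZ l f : completion_norm (l *: f) = `|l| * completion_norm f.
Proof.
have n0 : 0 <= `|l| * completion_norm f by rewrite mulr_ge0 ?dnorm_ge0.
rewrite -[RHS]sqrCK //; congr sqrtC.
have iZ g : inn (l *: f) g = l * inn f g.
  have := inn_linear l f 0 g; rewrite addr0 => ->.
  by rewrite -[X in _ + inn X _](addNr f) -scaleN1r inn_linear; ring.
rewrite /= iZ innC iZ rmorphM /= -innC exprMn dnormK /= normCK.
by ring.
Qed.

Lemma completion_norm0_eq0 f : completion_norm f = 0 -> f = 0.
Proof.
move=> f0; apply: completionP => x; apply/eqP.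
rewrite -normr_le0; apply: le_trans (completion_norm_apply f x) _.
by rewrite f0 mul0r.
Qed.

HB.instance Definition _ := Lmodule_isNormed.Build K completion
  completion_normD completion_normZ completion_norm0_eq0.

Lemma inn_norm f : inn f f = `|f| ^+ 2.
Proof. by rewrite [RHS](@dnormK R completion_prehilbert). Qed.

Lemma completion_normE f : `|f| = completion_norm f.
Proof. by []. Qed.

Lemma approx_norm f v e : 0 <= e -> approx f v e -> `|f - embed v| <= e.
Proof. by move=> e0 fv; apply: completion_norm_le => // x; exact: fv. Qed.

Lemma norm_embed v : `|embed v| = dnorm v.
Proof. exact: completion_norm_embed. Qed.

(** Vectors [v n] approximating centres of small balls of the filter have pointwise limits
    [dot (v n) x]. The limit functional is approached in the dual norm, so it lies in the
    completion. *)
Lemma completion_complete (F : set_system completion) :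
  ProperFilter F -> cauchy F -> cvg F.
Proof.
move=> FF /cauchyP Fc.
have iv n : 0 < n.+1%:R^-1 :> K by rewrite invr_gt0 ltr0n.
have [f Ff] := choice (fun n => Fc _ (iv n)).
have [v fv] := choice (fun n => completion_approx (f n) (iv n)).
have fve n : `|f n - embed (v n)| <= n.+1%:R^-1.
  by apply: approx_norm (fv n); exact: ltW.
have vv n m x : `|dot (v n) x - dot (v m) x| <=
    2 * dnorm x * (n.+1%:R^-1 + m.+1%:R^-1).
  have [g [/=]] := filter_ex (filterI (Ff n) (Ff m)).
  rewrite -!ball_normE /= => gn gm.
  rewrite (_ : _ - _ = (embed (v n) - embed (v m)) x) //.
  apply: le_trans (completion_norm_apply _ _) _; rewrite mulrAC ler_wpM2r ?dnorm_ge0 //.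
  rewrite -completion_normE.
  apply: le_trans (ler_distD (f n) _ _) _.
  apply: le_trans (lerD (lexx _) (ler_distD g _ _)) _.
  apply: le_trans (lerD (lexx _) (lerD (lexx _) (ler_distD (f m) _ _))) _.
  rewrite [`|_ - f n|]distrC [`|g - _|]distrC.
  rewrite (_ : 2 * _ = n.+1%:R^-1 + (n.+1%:R^-1 + (m.+1%:R^-1 + m.+1%:R^-1))).
    by rewrite !lerD // ltW.
  by ring.
(* The [+ 1] keeps the constant positive when [dnorm x] vanishes. *)
have lims x : exists l, forall n,
    `|dot (v n) x - l| <= 2 * (2 * dnorm x + 1) * n.+1%:R^-1.
  apply: complex_seq_cauchy_limit => [|n m].
    by rewrite ltr_wpDl // mulr_ge0 // dnorm_ge0.
  apply: le_trans (vv n m x) _; apply: ler_wpM2r; last by rewrite lerDl.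
  by rewrite addr_ge0 // ltW.
have [L Lv] := choice lims.
(* The rate in [lims] is not proportional to [dnorm x]; letting [m] grow in [vv] gives one that is,
   as [approx] demands. *)
have La n : approx L (v n) (2 * n.+1%:R^-1).
  move=> x; have dx := dnorm_ge0 x.
  apply: (@ler_mul_addgt0 _ _ _ (2 * (2 * dnorm x + 1) + 2 * dnorm x)) => [|d d0].
    by rewrite !(addr_ge0, mulr_ge0).
  have [m /ltW md] := invSn_small d0.
  rewrite distrC; apply: le_trans (ler_distD (dot (v m) x) _ _) _.
  apply: le_trans (lerD (vv n m x) (Lv x m)) _.
  rewrite [2 * dnorm x * _]mulrDr -addrA -mulrDl [2 * _^-1 * _]mulrAC lerD2l.
  by rewrite addrC ler_wpM2l // !(addr_ge0, mulr_ge0).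
have Lc : L \in completion_pred.
  apply/asboolP => e e0; have e2 : 0 < e / 2 by rewrite divr_gt0.
  have [n /ltW ne] := invSn_small e2.
  exists (v n) => x; apply: le_trans (La n x) _.
  by rewrite ler_wpM2r ?dnorm_ge0 // mulrC -ler_pdivlMr.
pose g := Completion Lc; apply/cvg_ex; exists g.
apply/cvgrPdist_lt => e e0; have e4 : 0 < e / 4 by rewrite divr_gt0.
have [n ne] := invSn_small e4; near=> h.
have nh : `|f n - h| < n.+1%:R^-1 by near: h; have := Ff n; rewrite -ball_normE.
apply: le_lt_trans (ler_distD (embed (v n)) _ _) _.
apply: le_lt_trans (lerD (lexx _) (ler_distD (f n) _ _)) _.
have gv : `|g - embed (v n)| <= 2 * n.+1%:R^-1.
  by apply: approx_norm => //; rewrite mulr_ge0 // ltW.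
have fv' : `|embed (v n) - f n| <= n.+1%:R^-1 by rewrite distrC.
rewrite (le_lt_trans (lerD gv (lerD fv' (ltW nh)))) //.
rewrite (_ : _ + _ = 4 * n.+1%:R^-1); last by ring.
by rewrite mulrC -ltr_pdivlMr.
Unshelve. all: by end_near. Qed.

HB.instance Definition _ := Uniform_isComplete.Build completion completion_complete.

Definition completion_hilbert : hilbert R :=
  @Hilbert R completion inn inn_linear innC inn_norm.

End Completion.

(** * Operators on the completion *)

Section CompletionOperators.
Variables (R : realType) (X : prehilbert R).
Local Notation K := R[i].

(** The default [0] is not reached when [S] is bounded and has an adjoint: see [precompE]. *)
Definition precomp (S : X -> X) (f : completion X) : completion X :=
  insubd 0 (fun x => f (S x)).

Variables (S T : X -> X) (M : K).
Hypothesis M0 : 0 <= M.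
Hypothesis TS : forall x y, dot (T x) y = dot x (S y).
Hypothesis Sb : forall x, dnorm (S x) <= M * dnorm x.

Lemma adjoint_sym x y : dot (S x) y = dot x (T y).
Proof. by rewrite dotC -TS -dotC. Qed.

Lemma approx_precomp (f : completion X) v e : 0 <= e -> approx f v e ->
  approx (fun x => f (S x)) (T v) (M * e).
Proof.
move=> e0 fv x; rewrite TS; apply: le_trans (fv _) _.
by rewrite [M * e]mulrC -mulrA ler_wpM2l.
Qed.

Lemma precompE f x : precomp S f x = f (S x).
Proof.
rewrite /precomp /insubd insubT //; apply/asboolP => e e0.
have M1 : 0 < M + 1 by rewrite ltr_wpDl.
have eM : 0 < e / (M + 1) by rewrite divr_gt0.
have [v fv] := completion_approx f eM.
exists (T v) => y; apply: le_trans (approx_precomp (ltW eM) fv _) _.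
rewrite ler_wpM2r ?dnorm_ge0 // mulrA ler_pdivrMr // mulrC.
by rewrite ler_wpM2l ?lerDl // ltW.
Qed.

Lemma precomp_embed v : precomp S (embed v) = embed (T v).
Proof. by apply: completionP => x; rewrite precompE; exact/esym/TS. Qed.

Lemma precomp_bounded f : `|precomp S f| <= M * `|f|.
Proof.
apply: completion_norm_le => [|x]; first exact: mulr_ge0.
rewrite precompE; apply: le_trans (completion_norm_apply _ _) _.
by rewrite -completion_normE [M * _]mulrC -mulrA ler_wpM2l.
Qed.

End CompletionOperators.

Lemma precomp_adjoint (R : realType) (X : prehilbert R) (S T : X -> X) (M : R[i])
    (f g : completion X) : 0 <= M ->
  (forall x y, dot (T x) y = dot x (S y)) ->
  (forall x, dnorm (S x) <= M * dnorm x) ->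
  (forall x, dnorm (T x) <= M * dnorm x) ->
  inn (precomp S f) g = inn f (precomp T g).
Proof.
move=> M0 TS Sb Tb; apply: is_inn_unique (innP _ _) _.
have [k k0 fk] := innP f (precomp T g).
exists (k * M) => [|w e e0 gw]; first exact: mulr_ge0.
rewrite (precompE M0 TS Sb) -mulrA; apply: fk; first exact: mulr_ge0.
move=> x; rewrite (precompE M0 (adjoint_sym TS) Tb).
exact: (approx_precomp (adjoint_sym TS) Tb e0 gw).
Qed.

(** * Operator norms with real values *)

Section OperatorNorm.
Variables (R : realType) (V W : normedModType R[i]).

Lemma rnormE (U : normedModType R[i]) (v : U) : `|v| = (rnorm v)%:C%C.
Proof. by rewrite /rnorm RRe_real ?normr_real. Qed.

Lemma rnorm_ge0 (U : normedModType R[i]) (v : U) : 0 <= rnorm v.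
Proof. by rewrite -ler0c -rnormE. Qed.

Lemma rnorm0 (U : normedModType R[i]) : rnorm (0 : U) = 0.
Proof. by apply: complexI; rewrite -rnormE normr0. Qed.

Lemma opnorm_le (T : V -> W) (M : R) : 0 <= M ->
  (forall v, rnorm (T v) <= M * rnorm v) -> (opnorm T <= M%:E)%E.
Proof.
move=> M0 h; apply: ge_ereal_sup => _ [v /= v1 <-].
rewrite lee_fin; apply: le_trans (h v) _.
by rewrite -[leRHS]mulr1 ler_wpM2l.
Qed.

Lemma opnorm_bound (T : V -> W) (M : R) (v : V) : linear T ->
  (opnorm T <= M%:E)%E -> rnorm (T v) <= M * rnorm v.
Proof.
move=> linT TM.
have TZ l u : T (l *: u) = l *: T u.
  have := linT l u 0; have := linT (-1) 0 0.
  by rewrite !addr0 scaler0 scaleN1r addNr => ->; rewrite addr0.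
have unit_ball u : rnorm u <= 1 -> rnorm (T u) <= M.
  by move=> u1; rewrite -lee_fin; apply: le_trans TM; apply: ereal_sup_ubound; exists u.
have [v0|vn0] := eqVneq (rnorm v) 0.
  have -> : v = 0 by apply/eqP; rewrite -normr_eq0 rnormE v0.
  rewrite -(scale0r (0 : V)) TZ !scale0r.
  by rewrite !rnorm0 mulr0.
have vp : 0 < rnorm v by rewrite lt0r vn0 rnorm_ge0.
have rZ (U : normedModType R[i]) (u : U) :
    rnorm ((rnorm v)^-1%:C%C *: u) = (rnorm v)^-1 * rnorm u.
  apply: complexI; rewrite -rnormE normrZ normc_real rmorphM /= -rnormE.
  by rewrite ger0_norm // invr_ge0 ltW.
have := unit_ball ((rnorm v)^-1%:C%C *: v).
rewrite TZ !rZ mulVf // => /(_ (lexx _)).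
by rewrite mulrC ler_pdivrMr.
Qed.

End OperatorNorm.

(** * Algebra of groupoids *)

Section Groupoid.
Variable Q : groupoid.
Implicit Types x y z : Q.

Lemma gmulVKr x : gmul x (gmul (ginv x) x) = x.
Proof.
have [_ _ <-] := gmulA (composablegV x) (composableVg x).
by have := gmulgK (composablegV x); rewrite ginvK.
Qed.

(** The axioms relate composability to products only. The converse inserts the common unit:
    [x = x u] and [y = u y] for [u = x^-1 x = y y^-1]. *)
Lemma composableP x y : composable (x, y) <-> grange (ginv x) = grange y.
Proof.
rewrite /grange ginvK; split=> [xy|e].
  have [uy _ _] := gmulA (composableVg x) xy.
  have uyE : gmul (gmul (ginv x) x) y = y.
    by have [_ _ ->] := gmulA (composableVg x) xy; rewrite gmulKg.
  by have := gmulgK uy; rewrite uyE.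
have [_ xu _] := gmulA (composablegV x) (composableVg x).
have [uy _ _] := gmulA (composablegV y) (composableVg y).
rewrite -e in uy; have [+ _ _] := gmulA xu uy.
by rewrite gmulVKr.
Qed.

Lemma composable_same_range x y : composable (ginv x, y) <-> grange x = grange y.
Proof. by rewrite composableP ginvK. Qed.

Lemma grangeM x y : composable (x, y) -> grange (gmul x y) = grange x.
Proof.
move=> xy; have [_ h _] := gmulA (composableVg x) xy.
exact/esym/composable_same_range.
Qed.

Lemma ginvM x y : composable (x, y) -> ginv (gmul x y) = gmul (ginv y) (ginv x).
Proof.
move=> xy; have [_ cxw _] := gmulA (composableVg x) xy.
have yw : gmul y (ginv (gmul x y)) = ginv x.
  by have := gmulgK cxw; rewrite gmulKg.
have [cwy _ _] := gmulA xy (composablegV y).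
have cyw : composable (y, ginv (gmul x y)).
  by apply/composableP; apply/esym; exact/composableP.
by have := gmulKg cyw; rewrite yw.
Qed.

Lemma grange_gmulV x y : grange x = grange y ->
  grange (gmul (ginv x) y) = grange (ginv x).
Proof. by move=> /composable_same_range; exact: grangeM. Qed.

Lemma gmulVK x y : grange x = grange y -> gmul x (gmul (ginv x) y) = y.
Proof. by move=> /composable_same_range/gmulKg; rewrite ginvK. Qed.

Lemma grange_id x : grange (grange x) = grange x.
Proof. by rewrite {2}/grange grangeM //; exact: composablegV. Qed.

Lemma ginv_grange x : ginv (grange x) = grange x.
Proof. by rewrite /grange ginvM ?ginvK //; exact: composablegV. Qed.

Lemma grange_gmul x : gmul (grange x) x = x.
Proof.
rewrite /grange; have [_ _ ->] := gmulA (composablegV x) (composableVg x).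
exact: gmulVKr.
Qed.

Lemma gmul_source x : gmul x (grange (ginv x)) = x.
Proof. by rewrite /grange ginvK gmulVKr. Qed.

Lemma ginv_gmulV x y : grange x = grange y ->
  ginv (gmul (ginv x) y) = gmul (ginv y) x.
Proof. by move=> /composable_same_range xy; rewrite ginvM // ginvK. Qed.

Lemma gmulV_mul x y z : grange x = grange y -> grange y = grange z ->
  gmul (ginv (gmul (ginv x) y)) (gmul (ginv x) z) = gmul (ginv y) z.
Proof.
move=> xy yz; rewrite ginv_gmulV //.
have c1 : composable (ginv y, x) by exact/composable_same_range.
have c2 : composable (x, gmul (ginv x) z).
  by apply/composableP; rewrite grange_gmulV // xy.
by have [_ _ ->] := gmulA c1 c2; rewrite gmulVK // xy.
Qed.

End Groupoid.

(** * The convolution algebra *)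

Section Convolution.
Variables (R : realType) (Q : groupoid).
Local Notation K := R[i].
Implicit Types (f g h : Q -> K^o) (x y z u : Q).

(** A list containing the support turns the sum over a possibly infinite fibre into an ordinary
    finite sum, where sums can be split and exchanged. *)
Lemma convolution_seq f g x (s : seq Q) : uniq s ->
  (forall y, y \in s -> grange y = grange x) ->
  (forall y, grange y = grange x -> f y * g (gmul (ginv y) x) != 0 -> y \in s) ->
  convolution f g x = \sum_(y <- s) f y * g (gmul (ginv y) x).
Proof.
move=> us sr cs; rewrite [RHS]fsbig_seq //; apply/esym.
apply: fsbig_widen => [y /sr|y [/= ry ys]] //.
by apply: contrapT => /eqP /(cs y ry).
Qed.

(* [s] may exceed the support of [f], so that one list can serve several
   functions. *)
Definition fiber_seq f u (s : seq Q) := [/\ uniq s,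
  forall y, y \in s -> grange y = u & forall y, grange y = u -> f y != 0 -> y \in s].

Definition finite_fibers f := forall u, exists s, fiber_seq f u s.

Lemma convolution_fiber f g x s : fiber_seq f (grange x) s ->
  convolution f g x = \sum_(y <- s) f y * g (gmul (ginv y) x).
Proof.
case=> us sr cs; apply: convolution_seq => // y ry.
by rewrite mulf_eq0 negb_or => /andP[fy _]; exact: cs.
Qed.

Lemma fiber_seqU f g u : finite_fibers f -> finite_fibers g ->
  exists2 s, fiber_seq f u s & fiber_seq g u s.
Proof.
move=> /(_ u)[s [us sr cs]] /(_ u)[t [ut tr ct]].
have us' : uniq (undup (s ++ t)) by exact: undup_uniq.
have r y : y \in undup (s ++ t) -> grange y = u.
  by rewrite mem_undup mem_cat => /orP[/sr|/tr].
exists (undup (s ++ t)); split=> // y yu fy; rewrite mem_undup mem_cat.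
  by rewrite cs.
by rewrite ct ?orbT.
Qed.

Lemma convolution_linearl (l : K) f f' g x : finite_fibers f -> finite_fibers f' ->
  convolution (fun y => l * f y + f' y) g x =
  l * convolution f g x + convolution f' g x.
Proof.
move=> ff ff'; have [s sf sf'] := fiber_seqU (grange x) ff ff'.
have sl : fiber_seq (fun y => l * f y + f' y) (grange x) s.
  case: sf sf' => us sr cs [_ _ cs']; split=> // y yu.
  have [f0|fn0] := eqVneq (f y) 0; last by move=> _; exact: cs.
  by rewrite f0 mulr0 add0r; exact: cs'.
rewrite !(convolution_fiber _ sf, convolution_fiber _ sf', convolution_fiber _ sl).
by rewrite mulr_sumr -big_split; apply: eq_bigr => y _; rewrite mulrDl mulrA.
Qed.

Lemma convolution_linearr (l : K) f g g' x : finite_fibers f ->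
  convolution f (fun y => l * g y + g' y) x =
  l * convolution f g x + convolution f g' x.
Proof.
move=> /(_ (grange x))[s sf]; rewrite !(convolution_fiber _ sf).
rewrite mulr_sumr -big_split; apply: eq_bigr => y _ /=.
by rewrite mulrDr mulrCA.
Qed.

Lemma convolutionA f g h : finite_fibers f -> finite_fibers g ->
  convolution (convolution f g) h = convolution f (convolution g h).
Proof.
move=> ff fg; apply/funext => x.
have [s sf] := ff (grange x); have [us sr cs] := sf.
have [b bg] := choice fg.
(* The list [t] contains the support of [f * g] on the fibre of [x]; distinct pairs may have the
   same product, hence [undup]. *)
pose t := undup [seq gmul z w | z <- s, w <- b (grange (ginv z))].
have zw z w : w \in b (grange (ginv z)) -> composable (z, w).
  by have [_ br _] := bg (grange (ginv z)) => /br bz; exact/composableP.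
have tr y : y \in t -> grange y = grange x.
  rewrite mem_undup => /allpairsPdep[z [w [zs wb ->]]].
  by rewrite grangeM ?sr //; exact: zw.
have ts z w : z \in s -> grange w = grange (ginv z) -> g w != 0 ->
    gmul z w \in t.
  move=> zs wz gw; rewrite mem_undup; apply/allpairsPdep; exists z, w; split=> //.
  by have [_ _ cb] := bg (grange (ginv z)); exact: cb.
rewrite (convolution_fiber _ sf).
have -> : convolution (convolution f g) h x =
    \sum_(y <- t) convolution f g y * h (gmul (ginv y) x).
  apply: convolution_seq => [|//|y ry]; first exact: undup_uniq.
  rewrite mulf_eq0 negb_or => /andP[+ _].
  have sy : fiber_seq f (grange y) s by rewrite ry.
  rewrite (convolution_fiber _ sy) => /eqP; apply: contra_notT => yt.
  rewrite big_seq big1 // => z zs; have [->|gn0] := eqVneq (g (gmul (ginv z) y)) 0.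
    by rewrite mulr0.
  have rzy : grange z = grange y by rewrite ry sr.
  by case/negP: yt; rewrite -(gmulVK rzy) ts // grange_gmulV.
transitivity (\sum_(y <- t) \sum_(z <- s)
    f z * (g (gmul (ginv z) y) * h (gmul (ginv y) x))).
  rewrite big_seq [RHS]big_seq; apply: eq_bigr => y /tr ry.
  have sy : fiber_seq f (grange y) s by rewrite ry.
  rewrite (convolution_fiber _ sy) mulr_suml; apply: eq_bigr => z _.
  by rewrite mulrA.
rewrite exchange_big big_seq [RHS]big_seq; apply: eq_bigr => z zs /=.
rewrite -mulr_sumr; congr (_ * _).
(* Substituting [w = z^-1 y] carries the fibre of [x] bijectively onto that of [z^-1 x], so the same
   list [t] serves for every [z]. *)
have -> : convolution g h (gmul (ginv z) x) =
    \sum_(w <- [seq gmul (ginv z) y | y <- t])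
      g w * h (gmul (ginv w) (gmul (ginv z) x)).
  apply: convolution_seq.
  - rewrite map_inj_in_uniq ?undup_uniq // => y y' /tr ry /tr ry' e.
    have rzy : grange z = grange y by rewrite ry sr.
    have rzy' : grange z = grange y' by rewrite ry' sr.
    by rewrite -(gmulVK rzy) e gmulVK.
  - move=> _ /mapP[y /tr ry ->]; have rz := sr _ zs.
    by rewrite !grange_gmulV ?rz ?ry.
  - move=> w; rewrite grange_gmulV ?(sr z) // => rw; rewrite mulf_eq0 negb_or => /andP[gw _].
    apply/mapP; exists (gmul z w); first exact: ts.
    by rewrite gmulKg //; apply/composableP.
rewrite big_map big_seq [RHS]big_seq; apply: eq_bigr => y /tr ry.
by rewrite gmulV_mul // sr.
Qed.

Lemma invol_convolution f g : finite_fibers f ->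
  invol (convolution f g) = convolution (invol g) (invol f).
Proof.
move=> ff; apply/funext => x.
have [s sf] := ff (grange (ginv x)); have [us sr cs] := sf.
rewrite /invol (convolution_fiber _ sf) rmorph_sum.
have xy y : grange y = grange (ginv x) -> composable (x, y).
  by move=> ry; apply/composableP.
rewrite (@convolution_seq _ _ _ [seq gmul x y | y <- s]).
- rewrite big_map big_seq [RHS]big_seq; apply: eq_bigr => y /sr ry /=.
  have cxy := xy y ry; have rxy := grangeM cxy.
  rewrite rmorphM mulrC ginv_gmulV // gmulKg //.
  by rewrite ginvM.
- rewrite map_inj_in_uniq // => y y' /sr ry /sr ry' e.
  by rewrite -(gmulKg (xy y ry)) e gmulKg //; exact: xy.
- by move=> _ /mapP[y /sr ry ->]; rewrite grangeM //; exact: xy.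
- move=> y ry; rewrite mulf_eq0 negb_or => /andP[_]; rewrite conjC_eq0 => fy.
  apply/mapP; exists (gmul (ginv x) y); last by rewrite gmulVK.
  apply: cs; first by rewrite grange_gmulV.
  by rewrite -ginv_gmulV.
Qed.

Lemma involK f : invol (invol f) = f.
Proof. by apply/funext => x; rewrite /invol ginvK conjCK. Qed.

Lemma invol_linear (l : K) f g : invol (fun x => l * f x + g x) =
  (fun x => l^* * invol f x + invol g x).
Proof. by apply/funext => x; rewrite /invol rmorphD rmorphM. Qed.

End Convolution.

(** * Continuous functions of compact support *)

Lemma compact_finite_subcover (T : topologicalType) (K : set T) (V : T -> set T) :
  compact K -> (forall x, open (V x) /\ V x x) ->
  exists s : seq T, K `<=` \bigcup_(x in [set` s]) V x.
Proof.
move=> cK oV; have [->|/set0P[p _]] := eqVneq K set0; first by exists nil.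
pose pT : ptopologicalType := HB.pack_for ptopologicalType T (isPointed.Build T p).
have : @compact pT K by [].
rewrite compact_cover => /(_ pT setT V) []; first by move=> x _; have [] := oV x.
  by move=> x _; exists x => //; have [] := oV x.
move=> D _ KD; exists (finmap.enum_fset D) => x /KD[y Dy Vyx].
by exists y.
Qed.

Section ComplexContinuity.
Variables (R : realType) (T : topologicalType).
Local Notation K := R[i].

Lemma continuous_near_zero (f : T -> K^o) x : (\forall y \near x, f y = 0) ->
  f @ x --> f x.
Proof.
move=> f0; have -> : f x = 0 by exact: nbhs_singleton f0.
 exact: cvg_near_cst.
Qed.

Lemma continuous_real_complex (f : T -> R) : continuous f ->
  continuous (fun x => (f x)%:C%C : K^o).
Proof.
move=> cf x; apply/cvgrPdist_lt => -[e i]; rewrite ltcE /= => /andP[/eqP -> e0].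
have /cvgrPdist_lt/(_ _ e0) h := cf x; near=> y.
rewrite -rmorphB normc_real ltcR; by near: y.
Unshelve. all: by end_near. Qed.

Lemma continuous_Re (f : T -> K^o) : continuous f ->
  continuous (fun x => complex.Re (f x)).
Proof.
move=> cf x; apply/cvgrPdist_lt => e e0.
have e0c : 0 < e%:C%C :> K by rewrite ltcE /= eqxx.
have /cvgrPdist_lt/(_ _ e0c) h := cf x; near=> y.
rewrite -ltcR -raddfB; apply: le_lt_trans (normc_ge_Re _) _.
by near: y.
Unshelve. all: by end_near. Qed.

Lemma continuous_conj (f : T -> K^o) : continuous f ->
  continuous (fun x => (f x)^* : K^o).
Proof.
move=> cf x; apply/cvgrPdist_lt => e e0.
have /cvgrPdist_lt/(_ _ e0) h := cf x; near=> y.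
by rewrite -rmorphB norm_conjC; near: y.
Unshelve. all: by end_near. Qed.

End ComplexContinuity.

Section CompactlySupported.
Variables (R : realType) (Q : groupoid).
Hypothesis Q_T2 : hausdorff_space Q.
Local Notation K := R[i].
Local Notation CcQ := (Cc R Q).
Implicit Types (f g : Q -> K^o) (x y : Q).

Definition csupp f : set Q := closure [set x | f x != 0].

Lemma csupp_ne0 f x : f x != 0 -> csupp f x.
Proof. exact: (@subset_closure _ [set x | f x != 0]). Qed.

Lemma csupp_eq0 f x : ~ csupp f x -> f x = 0.
Proof. by move=> /(contra_not (@csupp_ne0 f x)) /negP/negPn/eqP. Qed.

Lemma csupp_near f x : ~ csupp f x -> \forall y \near x, f y = 0.
Proof.
move=> nx; have oC : open (~` csupp f) by rewrite openC; exact: closed_closure.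
have : nbhs x (~` csupp f) by exact: open_nbhs_nbhs.
by apply: filterS => y; exact: csupp_eq0.
Qed.

Lemma csuppS f g : (forall x, f x = 0 -> g x = 0) -> csupp g `<=` csupp f.
Proof.
move=> fg; apply: closureS => x; apply: contra => /eqP fx.
by rewrite fg.
Qed.

Lemma CcP f (C : set Q) : continuous f -> compact C ->
  (forall x, f x != 0 -> C x) -> CcQ f.
Proof.
move=> cf cC fC; split=> //; apply: (subclosed_compact _ cC).
  exact: closed_closure.
have clC := compact_closed Q_T2 cC.
by rewrite [X in _ `<=` X](closure_id C).1 //; exact: closureS.
Qed.

Lemma Cc_supp f : CcQ f -> compact (csupp f). Proof. by case. Qed.

Lemma Cc_continuous f : CcQ f -> continuous f. Proof. by case. Qed.

Lemma Cc0 : CcQ (fun=> 0).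
Proof.
apply: (@CcP _ set0) => [x||x]; [exact: cvg_cst|exact: compact0|].
by rewrite eqxx.
Qed.

Lemma Cc_lin (l : K) f g : CcQ f -> CcQ g -> CcQ (fun x => l * f x + g x).
Proof.
move=> [cf kf] [cg kg]; apply: (@CcP _ (csupp f `|` csupp g)) => [x||x].
- apply: (@cvgD _ K^o); last exact: cg.
  by apply: cvgM; [exact: cvg_cst|exact: cf].
- exact: compactU.
- move=> h; apply: contrapT => /not_orP[/csupp_eq0 fx /csupp_eq0 gx].
  by move: h; rewrite fx gx mulr0 addr0 eqxx.
Qed.

Lemma Cc_add f g : CcQ f -> CcQ g -> CcQ (fun x => f x + g x).
Proof.
move=> cf cg; have := Cc_lin 1 cf cg.
by congr (CcQ _); apply/funext => x; rewrite mul1r.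
Qed.

Lemma Cc_mulr f (s : Q -> K^o) : CcQ f -> continuous s ->
  CcQ (fun x => f x * s x).
Proof.
move=> [cf kf] cs; apply: (CcP _ kf) => [x|x].
  by apply: cvgM; [exact: cf|exact: cs].
by rewrite mulf_eq0 negb_or => /andP[fx _]; exact: csupp_ne0.
Qed.

Lemma Cc_mull f (s : Q -> K^o) : CcQ f -> continuous s ->
  CcQ (fun x => s x * f x).
Proof.
move=> cf cs; have := Cc_mulr cf cs.
by congr (CcQ _); apply/funext => x; rewrite mulrC.
Qed.

(** Off the closed support of [f] the quotient vanishes in a neighbourhood, so zeros of [s] there do
    no harm to continuity. *)
Lemma Cc_div f (s : Q -> K^o) : CcQ f -> continuous s ->
  (forall x, csupp f x -> s x != 0) -> CcQ (fun x => f x / s x).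
Proof.
move=> [cf kf] cs s0; apply: (CcP _ kf) => [x|x].
  have [fx|fx] := pselect (csupp f x).
    by apply: cvgM; [exact: cf|apply: cvgV (cs x); exact: s0].
  apply: continuous_near_zero; have := csupp_near fx.
  by apply: filterS => y ->; rewrite mul0r.
by rewrite mulf_eq0 negb_or => /andP[fx _]; exact: csupp_ne0.
Qed.

Lemma Cc_invol f : CcQ f -> CcQ (invol f).
Proof.
move=> [cf kf]; apply: (@CcP _ (@ginv Q @` csupp f)).
- apply: continuous_conj.
  exact: (continuous_compose (@ginv_continuous Q) cf).
- apply: continuous_compact kf; apply: continuous_subspaceT.
  exact: ginv_continuous.
- move=> x; rewrite conjC_eq0 => fx; exists (ginv x); last exact: ginvK.
  exact: csupp_ne0.
Qed.

Lemma Cc_bounded f : CcQ f -> exists2 M : R, 0 <= M & forall x, `|f x| <= M%:C%C.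
Proof.
move=> [cf kf]; pose F (x : Q) : R^o := complex.Re `|f x|.
have cF : continuous F.
  apply: continuous_Re => x; apply: (@continuous_comp _ K^o K^o f Num.norm).
    exact: cf.
  exact: norm_continuous.
have : compact (F @` csupp f).
  by apply: continuous_compact kf; exact: continuous_subspaceT.
move=> /compact_bounded/pinfty_ex_gt0[M /ltW M0 FM]; exists M => // x.
have [fx|/csupp_eq0 ->] := pselect (csupp f x); last by rewrite normr0 ler0c.
rewrite -[`|f x|]RRe_real ?normr_real // lecR.
by apply: le_trans (FM _ (imageP _ fx)); exact: ler_norm.
Qed.

Hypothesis Q_lc : locally_compact [set: Q].

Lemma bump_function x (U : set Q) : open U -> U x ->
  exists u : Q -> K^o, [/\ CcQ u, forall y, 0 <= u y, u x != 0 & csupp u `<=` U].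
Proof.
move=> oU Ux; have [C xC [cC clC]] := Q_lc (I : [set: Q] x).
have {}xC : nbhs x C.
  by move: xC; rewrite withinET.
pose W := U `&` C^°.
have oW : open W by apply: openI => //; exact: open_interior.
have Wx : W x by split.
have cW : closed (~` W) by rewrite closedC.
have nWx : ~ (~` W) x by apply.
have sep := @locally_compact_completely_regular Q R Q_lc Q_T2 x (~` W) cW nWx.
have [g [cg _ gx gW]] := (@uniform_separatorP _ R _ _).1 sep.
have gW1 y : g y <= 2^-1 -> W y.
  move=> gy; apply: contrapT => nW; have := gW (g y) (imageP g (nW : (~` W) y)).
  by move=> /= e; move: gy; rewrite e; apply/negP; rewrite -ltNge invf_lt1 // ltr1n.
(* Here [g] is [0] at [x] and [1] off [W]. Cutting at the intermediate level [2^-1] keeps the closed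
   support, and not just the set where [v] is nonzero, inside [W]. *)
pose v y : R := Num.max 0 (2^-1 - g y).
have cv : continuous v.
  move=> y; apply: (@continuous_max R Q (fun=> 0) (fun y => 2^-1 - g y)).
    exact: cvg_cst.
  by apply: cvgB; [exact: cvg_cst|exact: cg].
have half (y : Q) : (v y)%:C%C != 0 :> K -> g y <= 2^-1.
  move=> vy; rewrite leNgt; apply/negP => gy; case/negP: vy; apply/eqP.
  by rewrite /v max_l // subr_le0 ltW.
have cl : closed [set y | g y <= 2^-1].
  exact: (closed_comp (fun y _ => cg y) (@closed_le _ 2^-1)).
have sub : csupp (fun y => (v y)%:C%C : K^o) `<=` [set y | g y <= 2^-1].
  rewrite [X in _ `<=` X](closure_id _).1 //; apply: closureS => y; exact: half.
exists (fun y => (v y)%:C%C); split.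
- apply: (@CcP _ C) => //; first exact: continuous_real_complex.
  by move=> y /half/gW1[_ /interior_subset].
- by move=> y; rewrite ler0c le_max lexx.
- have gx0 : g x = 0 by apply: gx; exists x.
  have h2 : 0 < 2^-1 :> R by rewrite invr_gt0.
  rewrite /v gx0 subr0 max_r ?ltW //.
  by apply/eqP => /(congr1 (@complex.Re R)) /=; apply/eqP; rewrite gt_eqF.
- by move=> y /sub/gW1[].
Qed.

End CompactlySupported.

(** * Partitions of unity *)

Section Decomposition.
Variables (R : realType) (Q : groupoid).
Hypotheses (Q_T2 : hausdorff_space Q) (Q_lc : locally_compact [set: Q]).
Local Notation K := R[i].
Local Notation CcQ := (Cc R Q).
Implicit Types (f g : Q -> K^o) (x y : Q).

Variable cov : set (set Q).
Hypothesis covP : forall x, exists U, [/\ cov U, open U & U x].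

Lemma bump_family : exists u : Q -> Q -> K^o,
  (forall x, [/\ CcQ (u x), forall y, 0 <= u x y &
                 exists2 U, cov U & csupp (u x) `<=` U]) /\
  (forall C : set Q, compact C -> exists s : seq Q,
    forall y, C y -> exists2 x, x \in s & u x y != 0).
Proof.
have loc x : exists u : Q -> K^o, [/\ CcQ u, forall y, 0 <= u y, u x != 0 &
    exists2 U, cov U & csupp u `<=` U].
  have [U [cU oU Ux]] := covP x.
  have [u [? ? ? ?]] := bump_function R Q_T2 Q_lc oU Ux.
  by exists u; split=> //; exists U.
have [u hu] := choice loc.
exists u; split=> [x|C cC]; first by have [] := hu x.
have [|s sC] := @compact_finite_subcover Q C (fun x => [set y | u x y != 0]) cC.
  move=> x; have [[cu _] _ uxx _] := hu x; split=> //.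
  rewrite (_ : [set y | _] = u x @^-1` [set~ (0 : K^o)]); last first.
    by apply/seteqP; split=> y /= /eqP.
  apply: open_comp; first by move=> y _; exact: cu.
  rewrite openC; apply: accessible_closed_set1.
  by apply: hausdorff_accessible; exact: norm_hausdorff.
by exists s => y /sC[x xs uy]; exists x.
Qed.

(** A partition of unity packaged as induction: the sum [t] of finitely many bumps is nonzero on the
    support of [f], and [f] is the sum of the pieces [f / t * u x], each supported in a member of
    the cover. *)
Lemma Cc_local_ind (P : (Q -> K^o) -> Prop) :
  P (fun=> 0) ->
  (forall f g, CcQ f -> CcQ g -> P f -> P g -> P (fun x => f x + g x)) ->
  (forall f U, CcQ f -> cov U -> csupp f `<=` U -> P f) ->
  forall f, CcQ f -> P f.
Proof.
move=> P0 PD PU f cf.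
have [u [hu cover_u]] := bump_family.
have [s hs] := cover_u _ (Cc_supp cf).
pose t y := \sum_(x <- s) u x y.
have ct : continuous t.
  rewrite /t; elim: s {hs t} => [|x s IHs].
    by under eq_fun do rewrite big_nil; move=> y; exact: cvg_cst.
  under eq_fun do rewrite big_cons; move=> y; apply: (@cvgD _ K^o).
    by have [[cu _] _ _] := hu x; exact: cu.
  exact: IHs.
have t0 y : csupp f y -> t y != 0.
  move=> /hs[x xs uxy]; rewrite gt_eqF // /t (big_rem _ xs) /=.
  have [_ u0 _] := hu x; rewrite ltr_pwDl //; first by rewrite lt0r uxy u0.
  by apply: sumr_ge0 => z _; have [_ + _] := hu z; exact.
have cft := Cc_div Q_T2 cf ct t0.
have cus x : CcQ (fun y => f y / t y * u x y).
  by have [[cu _] _ _] := hu x; exact: Cc_mulr.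
have Ps : forall r : seq Q,
    let h := fun y => \sum_(x <- r) f y / t y * u x y in CcQ h /\ P h.
  elim=> [|x r [ch Ph]] /=.
    rewrite (_ : (fun y => _) = fun=> 0); last by apply/funext => y; rewrite big_nil.
    by split; [exact: Cc0|exact: P0].
  rewrite (_ : (fun y => _) = fun y => f y / t y * u x y +
    \sum_(x <- r) f y / t y * u x y); last by apply/funext => y; rewrite big_cons.
  split; first exact: Cc_add.
  apply: PD => //; have [_ _ [U cU uU]] := hu x; apply: (PU _ U) => //.
  by apply: subset_trans uU; apply: csuppS => y ->; rewrite mulr0.
have -> : f = (fun y => \sum_(x <- s) f y / t y * u x y).
  apply/funext => y; rewrite -mulr_sumr -/(t y).
  have [fy|/csupp_eq0 ->] := pselect (csupp f y); last by rewrite !mul0r.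
  by rewrite divfK // t0.
by have [] := Ps s.
Qed.

End Decomposition.

Lemma closed_equalizer (S T : topologicalType) (a b : S -> T) :
  hausdorff_space T -> continuous a -> continuous b ->
  closed [set p | a p = b p].
Proof.
move=> hT ca cb p clp; apply: hT => A B hA hB.
have hA' : nbhs p (a @^-1` A) by exact: ca.
have hB' : nbhs p (b @^-1` B) by exact: cb.
have [q [qab [/= qA qB]]] := clp _ (filterI hA' hB').
by exists (a q); split=> //; rewrite qab.
Qed.

(** * Convolution on an r-discrete groupoid *)

Section RDiscrete.
Variables (R : realType) (Q : groupoid).
Hypotheses (Q_T2 : hausdorff_space Q) (Q_lc : locally_compact [set: Q]).
Hypothesis Q_rd : r_discrete Q.
Local Notation K := R[i].
Local Notation CcQ := (Cc R Q).
Implicit Types (f g : Q -> K^o) (x y : Q).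

Lemma gmul_cvg (T : topologicalType) (a b : T -> Q) (t : T) :
  a @ t --> a t -> b @ t --> b t ->
  (\forall s \near t, composable (a s, b s)) ->
  gmul (a s) (b s) @[s --> t] --> gmul (a t) (b t).
Proof.
move=> ca cb cab.
have /subspace_continuousP/(_ (a t, b t)) := @gmul_continuous Q.
move=> /(_ (nbhs_singleton cab)) /= h; apply: cvg_trans h => W /= [[A B] /= [hA hB] ABW].
have hA' : nbhs t (a @^-1` A) by exact: ca.
have hB' : nbhs t (b @^-1` B) by exact: cb.
apply: (filterS _ (filterI hA' (filterI hB' cab))) => s [/= As [Bs cs]].
exact: (ABW (a s, b s)).
Qed.

Lemma grange_continuous : continuous (@grange Q).
Proof.
move=> x; apply: (@gmul_cvg Q id (@ginv Q)); first exact: cvg_id.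
  exact: ginv_continuous.
by apply: nearW => y; exact: composablegV.
Qed.

Lemma range_map_continuous : continuous (@range_map Q).
Proof. exact/continuous_to_sub/grange_continuous. Qed.

Lemma range_mapP x y : range_map x = range_map y <-> grange x = grange y.
Proof.
split=> [/(congr1 val)//|e]; exact: val_inj.
Qed.

Definition r_section (U : set Q) := exists s : units Q -> Q,
  [/\ open (@range_map Q @` U), {within @range_map Q @` U, continuous s} &
      {in U, cancel (@range_map Q) s}].

Lemma r_section_inj (U : set Q) x y : r_section U -> U x -> U y ->
  grange x = grange y -> x = y.
Proof.
move=> [s [_ _ sK]] Ux Uy /range_mapP e.
by rewrite -[x]sK ?inE // e sK ?inE.
Qed.

Lemma r_section_cover x : exists U, [/\ r_section U, open U & U x].
Proof.
have [U [s [[oU Ux orU] [_ cs sK]]]] := Q_rd x.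
by exists U; split=> //; exists s.
Qed.

Lemma Cc_finite_fibers f : CcQ f -> finite_fibers f.
Proof.
apply: (Cc_local_ind Q_T2 Q_lc r_section_cover).
- by move=> u; exists nil; split=> // y _; rewrite eqxx.
- move=> {}f g _ _ ff fg u; have [s [us sr cs] [_ _ cs']] := fiber_seqU u ff fg.
  exists s; split=> // y yu; have [f0|fn0] := eqVneq (f y) 0.
    by rewrite f0 add0r; exact: cs'.
  by move=> _; exact: cs.
- move=> {}f U _ sU fU u.
  have [[y ry fy]|no] := pselect (exists2 y, grange y = u & f y != 0).
    exists [:: y]; split=> // [z|z rz fz]; first by rewrite inE => /eqP ->.
    rewrite inE; apply/eqP; apply: (r_section_inj sU); last by rewrite ry.
      exact/fU/csupp_ne0.
    exact/fU/csupp_ne0.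
  exists nil; split=> // y yu fy; case: no; by exists y.
Qed.

(** If [a z] is the point of [U] with the range of [z], the convolution at [z] is the single term
    [f (a z) * g ((a z)^-1 z)]. Ranges outside the compact, hence closed, image of the support give
    zero locally. *)
Lemma convolution_section_continuous f g (U : set Q) : CcQ f -> r_section U ->
  csupp f `<=` U -> continuous g -> continuous (convolution f g).
Proof.
move=> cf sU fU cg x; have [s [oV cs sK]] := sU.
have cC : compact (@grange Q @` csupp f).
  apply: continuous_compact (Cc_supp cf); apply: continuous_subspaceT.
  exact: grange_continuous.
have clC := compact_closed Q_T2 cC.
have [[y0 fy0 ry0]|nx] := pselect ((@grange Q @` csupp f) (grange x)); last first.
  apply: continuous_near_zero; have : nbhs x (@grange Q @^-1` (~` (@grange Q @` csupp f))).
    apply: grange_continuous; apply: open_nbhs_nbhs; split=> //.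
    by rewrite openC.
  apply: filterS => z nz; apply: fsbig1 => y /= yz.
  by rewrite csupp_eq0 ?mul0r // => fy; apply: nz; exists y.
pose a (z : Q) := s (range_map z).
have Vx : (@range_map Q @` U) (range_map x).
  by exists y0; [exact: fU|exact/range_mapP].
have nV : \forall z \near x, (@range_map Q @` U) (range_map z).
  by apply: range_map_continuous; exact: open_nbhs_nbhs.
have aP z : (@range_map Q @` U) (range_map z) -> U (a z) /\ grange (a z) = grange z.
  move=> [y Uy e]; rewrite /a -e sK ?inE //; split=> //; exact/range_mapP.
have ca : a @ x --> a x.
  apply: (@continuous_comp _ _ _ (@range_map Q) s); first exact: range_map_continuous.
  move: cs; rewrite continuous_open_subspace // => /(_ (range_map x)); apply.
  by rewrite inE.
have cm : gmul (ginv (a z)) z @[z --> x] --> gmul (ginv (a x)) x.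
  apply: (@gmul_cvg Q (fun z => ginv (a z)) id) => //.
    exact: (continuous_comp ca (@ginv_continuous Q _)).
  by apply: filterS nV => z /aP[_ /composable_same_range].
have E : \forall z \near x, convolution f g z = f (a z) * g (gmul (ginv (a z)) z).
  apply: filterS nV => z /aP[Uaz raz].
  have sz : fiber_seq f (grange z) [:: a z].
    split=> // [y|y ry fy]; first by rewrite inE => /eqP ->.
    rewrite inE; apply/eqP; apply: (r_section_inj sU) => //; last by rewrite raz.
    exact/fU/csupp_ne0.
  by rewrite (convolution_fiber _ sz) big_seq1.
have c1 : f (a z) @[z --> x] --> f (a x).
  by apply: (@continuous_comp _ _ _ a f) => //; exact: Cc_continuous.
have c2 : g (gmul (ginv (a z)) z) @[z --> x] --> g (gmul (ginv (a x)) x).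
  exact: (@continuous_comp _ _ _ (fun z => gmul (ginv (a z)) z) g x cm (cg _)).
rewrite /continuous_at (nbhs_singleton E).
apply: cvg_trans (cvgM c1 c2).
by apply: near_eq_cvg; apply: filterS E => z ->.
Qed.

Lemma convolution_continuous f g : CcQ f -> continuous g ->
  continuous (convolution f g).
Proof.
move=> cf; move: f cf g.
apply: (Cc_local_ind Q_T2 Q_lc r_section_cover) =>
  [g cg|f f' cf cf' Pf Pf' g cg|f U cf sU fU g cg].
- rewrite (_ : convolution _ _ = fun=> 0); first by move=> x; exact: cvg_cst.
  by apply/funext => x; apply: fsbig1 => y _; rewrite mul0r.
- have -> : convolution (fun x => f x + f' x) g =
      fun x => convolution f g x + convolution f' g x.
    apply/funext => x; rewrite -[X in _ = X + _]mul1r -convolution_linearl.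
    + rewrite (_ : (fun y => 1 * f y + f' y) = fun y => f y + f' y) //.
      by apply/funext => y; rewrite mul1r.
    + exact: Cc_finite_fibers.
    + exact: Cc_finite_fibers.
  by move=> x; apply: (@cvgD _ K^o); [exact: Pf|exact: Pf'].
- exact: convolution_section_continuous sU fU cg.
Qed.

Lemma closed_composable : closed (@composable Q).
Proof.
rewrite (_ : composable = [set p : Q * Q | grange (ginv p.1) = grange p.2]); last first.
  by apply/seteqP; split=> -[x y] /composableP.
apply: closed_equalizer => //.
  apply: continuous_compose; last exact: grange_continuous.
  by apply: continuous_compose; [move=> p; exact: cvg_fst|exact: ginv_continuous].
by apply: continuous_compose; [move=> p; exact: cvg_snd|exact: grange_continuous].
Qed.

Lemma convolution_ne0 f g x : convolution f g x != 0 ->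
  exists y, [/\ grange y = grange x, f y != 0 & g (gmul (ginv y) x) != 0].
Proof.
move=> /eqP h; apply: contrapT => no; apply: h; apply: fsbig1 => y ry.
apply/eqP; rewrite -[_ == _]negbK mulf_eq0 negb_or; apply/negP => /andP[fy gy].
by apply: no; exists y.
Qed.

Lemma Cc_convolution f g : CcQ f -> CcQ g -> CcQ (convolution f g).
Proof.
move=> cf cg; pose C := (csupp f `*` csupp g) `&` composable.
apply: (@CcP _ _ Q_T2 _ ((fun p : Q * Q => gmul p.1 p.2) @` C)).
- exact/convolution_continuous/Cc_continuous.
- apply: continuous_compact.
    by apply: continuous_subspaceW (@gmul_continuous Q) => p [].
  have cK : compact (csupp f `*` csupp g).
    by apply: compact_setX; exact: Cc_supp.
  apply: subclosed_compact cK _; last by move=> p [].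
  apply: closedI; last exact: closed_composable.
  have clf : closed (fst @^-1` csupp f : set (Q * Q)).
    apply: closed_comp (@closed_closure _ _) => p _; exact: cvg_fst.
  have clg : closed (snd @^-1` csupp g : set (Q * Q)).
    apply: closed_comp (@closed_closure _ _) => p _; exact: cvg_snd.
  exact: closedI clf clg.
- move=> x /convolution_ne0[y [ry fy gy]]; exists (y, gmul (ginv y) x).
    split; first by split; exact: csupp_ne0.
    by apply/composableP; rewrite grange_gmulV.
  exact: gmulVK.
Qed.

End RDiscrete.

(** * Functions supported in a section; restriction to the kernel *)

Section SectionMultiplier.
Variables (R : realType) (Q : groupoid).
Hypotheses (Q_T2 : hausdorff_space Q) (Q_lc : locally_compact [set: Q]).
Hypothesis Q_rd : r_discrete Q.
Local Notation K := R[i].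
Local Notation CcQ := (Cc R Q).
Variables (f : Q -> K^o) (U : set Q).
Hypotheses (Ccf : CcQ f) (U_sec : r_section U) (fU : csupp f `<=` U).
Implicit Types (k : Q -> K^o) (x y : Q).

Let ff : finite_fibers f := Cc_finite_fibers Q_T2 Q_lc Q_rd Ccf.
Let ffi : finite_fibers (invol f) :=
  Cc_finite_fibers Q_T2 Q_lc Q_rd (Cc_invol Q_T2 Ccf).

(** The value of [f^* f] at the unit [r(x)], that is, the sum of [|f(y^-1)|^2] over [y] in the fibre
    of [x]. The convolution form yields continuity and boundedness at once. *)
Definition fiber_weight x : K^o := convolution (invol f) f (grange x).

Lemma fiber_weight_continuous : continuous fiber_weight.
Proof.
apply: (@continuous_compose _ _ _ (@grange Q) (convolution (invol f) f)).
  exact: grange_continuous.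
by apply: Cc_continuous; apply: Cc_convolution => //; exact: Cc_invol.
Qed.

Lemma fiber_weight_bounded : exists2 M : R, 0 <= M &
  forall x, `|fiber_weight x| <= M%:C%C.
Proof.
have [|M M0 fM] := @Cc_bounded R Q (convolution (invol f) f).
  by apply: Cc_convolution => //; exact: Cc_invol.
by exists M => // x; exact: fM.
Qed.

Lemma fiber_weight_range x y : grange x = grange y -> fiber_weight x = fiber_weight y.
Proof. by rewrite /fiber_weight => ->. Qed.

Lemma fiber_weight_sum x s : fiber_seq (invol f) (grange x) s ->
  fiber_weight x = \sum_(y <- s) `|f (ginv y)| ^+ 2.
Proof.
move=> fs; have fs' : fiber_seq (invol f) (grange (grange x)) s by rewrite grange_id.
have [_ sr _] := fs.
rewrite /fiber_weight (convolution_fiber _ fs') big_seq [RHS]big_seq.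
apply: eq_bigr => y /sr <-; rewrite /invol normCK mulrC; congr (f _ * _).
by rewrite -{2}[y]ginvK gmul_source.
Qed.

Lemma fiber_weight_ge0 x : 0 <= fiber_weight x.
Proof.
have [s /fiber_weight_sum ->] := ffi (grange x).
by apply: sumr_ge0 => y _; rewrite exprn_ge0.
Qed.

Lemma fiber_weight_gt0 x : f (ginv x) != 0 -> 0 < fiber_weight x.
Proof.
move=> fx; have [s fs] := ffi (grange x); rewrite (fiber_weight_sum fs).
have [_ _ cs] := fs; rewrite (big_rem x) /=; last first.
  by apply: cs => //; rewrite conjC_eq0.
by rewrite ltr_pwDl ?exprn_gt0 ?normr_gt0 ?sumr_ge0 // => y _; rewrite exprn_ge0.
Qed.

(* [invol f * f] is supported on the unit space because the range map is
   injective on the support of [f]. *)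
Lemma section_multiplier k :
  convolution (invol f) (convolution f k) = fun x => fiber_weight x * k x.
Proof.
rewrite -convolutionA //; apply/funext => x.
have c1 : fiber_seq (convolution (invol f) f) (grange x) [:: grange x].
  split=> // [y|y ry].
    by rewrite inE => /eqP ->; exact: grange_id.
  move=> /convolution_ne0[z [rz fz fzy]]; rewrite inE -ry; apply/eqP.
  have e : gmul (ginv z) y = ginv z.
    apply: (r_section_inj U_sec); last exact: grange_gmulV.
      exact/fU/csupp_ne0.
    by apply/fU/csupp_ne0; move: fz; rewrite conjC_eq0.
  by rewrite -{1}(gmulVK rz) e -rz.
by rewrite (convolution_fiber _ c1) big_seq1 ginv_grange grange_gmul.
Qed.

End SectionMultiplier.

(** * The grading by degree; passage between [Q] and the kernel *)

Section KernelFunctions.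
Variables (R : realType) (Q : groupoid) (G : groupType) (c : Q -> G).
Hypothesis c_hom : groupoid_hom c.
Local Notation K := R[i].
Local Notation N := (kernel_groupoid c_hom).
Implicit Types (a b k : Q -> K^o) (f : N -> K^o) (x y : Q) (g : G).

(** For [g = 1] this is restriction to [N] viewed on [Q] ([ext_res]), so identities over [N] can be
    proved in [Q]. *)
Definition grade g a : Q -> K^o := fun x => if c x == g then a x else 0.

Lemma c_ginv x : c (ginv x) = (c x)^-1%g.
Proof.
have xV := composablegV x; have [_ VxV _] := gmulA (composableVg x) xV.
have := congr1 c (gmulKg xV); rewrite (c_hom VxV) (c_hom xV).
rewrite -[RHS]mulg1 => /mulgI e; apply: (mulgI (c x)).
by rewrite e mulgV.
Qed.

Lemma c_gmulV x y : grange y = grange x ->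
  c (gmul (ginv y) x) = ((c y)^-1 * c x)%g.
Proof. by move=> /composable_same_range yx; rewrite c_hom // c_ginv. Qed.

Lemma grade_id g a x : c x = g -> grade g a x = a x.
Proof. by move=> <-; rewrite /grade eqxx. Qed.

Lemma grade_eq0 g a x : c x <> g -> grade g a x = 0.
Proof. by move=> /eqP/negbTE; rewrite /grade => ->. Qed.

Lemma grade_linear g (l : K) a b :
  grade g (fun x => l * a x + b x) = (fun x => l * grade g a x + grade g b x).
Proof.
by apply/funext => x; rewrite /grade; case: eqP; rewrite // mulr0 addr0.
Qed.

Lemma grade_idem g a : grade g (grade g a) = grade g a.
Proof. by apply/funext => x; rewrite /grade; case: eqP. Qed.

Lemma grade1_invol a : grade 1%g (invol a) = invol (grade 1%g a).
Proof.
apply/funext => x; rewrite /grade /invol c_ginv (can2_eq invgK invgK) invg1.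
by case: eqP => // _; rewrite conjC0.
Qed.

(** The bimodule property of a conditional expectation: degrees multiply, so if the product and one
    factor have degree one, so has the other factor. *)
Lemma grade1_convl a b :
  grade 1%g (convolution (grade 1%g a) b) = convolution (grade 1%g a) (grade 1%g b).
Proof.
apply/funext => x; rewrite {1}/grade; case: eqP => cx.
  apply: eq_fsbigr => y /set_mem /= yx.
  have [cy|cy] := pselect (c y = 1%g); last by rewrite (grade_eq0 a cy) !mul0r.
  by rewrite [grade 1%g b _]grade_id // c_gmulV // cy cx mulVg.
apply/esym/fsbig1 => y /= yx.
have [cy|cy] := pselect (c y = 1%g); last by rewrite (grade_eq0 a cy) mul0r.
by rewrite [grade 1%g b _]grade_eq0 ?mulr0 // c_gmulV // cy invg1 mul1g.
Qed.

Lemma grade1_convr a b :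
  grade 1%g (convolution a (grade 1%g b)) = convolution (grade 1%g a) (grade 1%g b).
Proof.
apply/funext => x; rewrite {1}/grade; case: eqP => cx.
  apply: eq_fsbigr => y /set_mem /= yx; rewrite /grade c_gmulV // cx mulg1.
  by rewrite (can2_eq invgK invgK) invg1; case: eqP; rewrite // mulr0 mul0r.
apply/esym/fsbig1 => y /= yx; rewrite /grade c_gmulV //.
by case: eqP => [->|_]; rewrite ?mul0r // invg1 mul1g; case: eqP; rewrite // mulr0.
Qed.

(** This is how a homogeneous [h] carries one component of [k] into the kernel. *)
Lemma grade1_convolution g h k : (forall y, h y != 0 -> c y = g) ->
  grade 1%g (convolution h k) = convolution h (grade (g^-1)%g k).
Proof.
move=> hg; apply/funext => x; rewrite {1}/grade; case: eqP => cx.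
  apply: eq_fsbigr => y /set_mem /= yx.
  have [->|/hg cy] := eqVneq (h y) 0; first by rewrite !mul0r.
  by rewrite grade_id // c_gmulV // cy cx mulg1.
apply/esym/fsbig1 => y /= yx.
have [->|/hg cy] := eqVneq (h y) 0; first by rewrite mul0r.
rewrite grade_eq0 ?mulr0 // c_gmulV // cy.
by rewrite -{2}[(g^-1)%g]mulg1 => /mulgI.
Qed.

(* A function of the range and of the degree passes through the inner product
   [grade 1 (invol a * b)]. *)
Lemma grade1_radial (w : Q -> K) a b :
  (forall y z, grange y = grange z -> c y = c z -> w y = w z) ->
  grade 1%g (convolution (invol (fun x => w x * a x)) b) =
  grade 1%g (convolution (invol a) (fun x => (w x)^* * b x)).
Proof.
move=> wE; apply/funext => x; rewrite /grade; case: eqP => // cx.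
apply: eq_fsbigr => y /set_mem /= yx; rewrite /invol rmorphM /=.
(* Both arguments have range [r(y^-1)], and their degrees agree because [c x = 1]. *)
rewrite (wE (ginv y) (gmul (ginv y) x)); first by ring.
  by rewrite grange_gmulV.
by rewrite c_gmulV // cx mulg1 c_ginv.
Qed.

Definition res k : N -> K^o := fun n => k (val n).

Definition ext f : Q -> K^o := valL_ 0 f.

Lemma res_ext f : res (ext f) = f.
Proof. exact: (valLK 0 f). Qed.

Lemma ext_res k : ext (res k) = grade 1%g k.
Proof.
rewrite -[LHS]/((valL_ 0 \o sigL (hom_kernel c)) k) sigLK.
apply/funext => x; rewrite /restrict /grade /patch.
by case: eqP => cx; [rewrite mem_set|rewrite memNset].
Qed.

Lemma res_grade1 k : res (grade 1%g k) = res k.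
Proof. by rewrite -ext_res res_ext. Qed.

Lemma grade1_ext f : grade 1%g (ext f) = ext f.
Proof. by rewrite -{1}(res_ext f) -ext_res !res_ext. Qed.

Lemma ext_linear (l : K) f f' : ext (fun n => l * f n + f' n) =
  (fun x => l * ext f x + ext f' x).
Proof.
rewrite -[in RHS](grade1_ext f) -[in RHS](grade1_ext f') -grade_linear -ext_res.
by congr ext; apply/funext => n; rewrite /res -{1}(res_ext f) -{1}(res_ext f').
Qed.

Lemma val_grange (n : N) : val (grange n) = grange (val n) :> Q.
Proof. by rewrite /grange /= val_ker_mul //; exact: composablegV. Qed.

(** Each fibre of [N] is the degree-one part of a fibre of [Q], and [ext f] vanishes on the rest.
    Convolutions on [N] are thus handled by the results for [Q]. *)
Lemma kernel_convolution f f' :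
  convolution f f' = res (convolution (ext f) (ext f')).
Proof.
apply/funext => n; rewrite /res /convolution.
have -> : \sum_(y \in [set y | grange y = grange (val n)])
      ext f y * ext f' (gmul (ginv y) (val n)) =
    \sum_(y \in [set y | grange y = grange (val n) /\ hom_kernel c y])
      ext f y * ext f' (gmul (ginv y) (val n)).
  apply/esym/fsbig_widen => [y []//|y [/= ry] /not_andP[//|cy]].
  by rewrite -grade1_ext grade_eq0 ?mul0r.
rewrite (@reindex_fsbig _ _ _ N Q val [set y | grange y = grange n]).
  apply: eq_fsbigr => y /set_mem ry; have {}ry : grange y = grange n := ry.
  have yn : composable (val (ginv y), val n).
    by apply/composable_same_range; rewrite -!val_grange ry.
  by rewrite -{1}(res_ext f) -{1}(res_ext f') /res (val_ker_mul c_hom yn).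
split=> [y ry|y y' _ _|y [ry cy]].
- have {}ry : grange y = grange n := ry.
  by split; [rewrite -!val_grange ry|exact: set_valP].
- exact: val_inj.
- exists (SigSub (mem_set cy)) => //=.
  by apply: val_inj; rewrite !val_grange.
Qed.

Lemma ext_convolution f f' :
  ext (convolution f f') = convolution (ext f) (ext f').
Proof.
rewrite kernel_convolution ext_res -{1}(grade1_ext f) grade1_convl.
by rewrite !grade1_ext.
Qed.

Lemma res_invol k : res (invol k) = invol (res k).
Proof. by []. Qed.

Lemma ext_invol f : ext (invol f) = invol (ext f).
Proof. by rewrite -{1}(res_ext f) -res_invol ext_res grade1_invol grade1_ext. Qed.

Section Topology.
Hypothesis Q_T2 : hausdorff_space Q.
Hypothesis c_cont : continuous (c : Q -> discrete_topology G).

Lemma open_degree (A : set G) : open (c @^-1` A).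
Proof. by move/continuousP: c_cont; apply; exact: discrete_open. Qed.

Lemma closed_degree (A : set G) : closed (c @^-1` A).
Proof. by rewrite -openC; exact: (open_degree (~` A)). Qed.

Lemma degree_near x : \forall y \near x, c y = c x.
Proof. exact: (open_nbhs_nbhs (conj (open_degree [set c x]) erefl)). Qed.

Lemma grade_continuous g k : continuous k -> continuous (grade g k).
Proof.
move=> ck x; have [cx|cx] := pselect (c x = g); last first.
  apply: continuous_near_zero; apply: filterS (degree_near x) => y e.
  by rewrite grade_eq0 // e.
rewrite /continuous_at grade_id //; apply: cvg_trans (ck x).
apply: near_eq_cvg; apply: filterS (degree_near x) => y e.
by rewrite grade_id // e.
Qed.

Lemma Cc_ext f : Cc R N f -> Cc R Q (ext f).
Proof.
move=> [cf kf]; apply: (@CcP _ _ Q_T2 _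
  ((fun n : N => val n) @` closure [set n | f n != 0])).
- move=> x; have [cx|cx] := pselect (c x = 1%g); last first.
    apply: continuous_near_zero; apply: filterS (degree_near x) => y e.
    by rewrite -grade1_ext grade_eq0 // e.
  pose n : N := SigSub (mem_set (cx : hom_kernel c x)).
  have exn : ext f x = f n by rewrite -[in RHS](res_ext f).
  move=> W; rewrite exn => hW; have : nbhs n (f @^-1` W) by exact: cf.
  rewrite nbhsE => -[_ [[V oV <-] Vn] VW].
  have hV : nbhs x V by exact: open_nbhs_nbhs.
  apply: filterS (filterI hV (degree_near x)) => y [Vy cy].
  have cy1 : hom_kernel c y by rewrite /hom_kernel /= cy.
  have := VW (SigSub (mem_set cy1)) Vy.
  by rewrite /= -[X in W (X _)](res_ext f).
- apply: continuous_compact kf; apply: continuous_subspaceT; exact: val_continuous.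
- move=> x ex; have [cx|cx] := pselect (c x = 1%g); last first.
    by move: ex; rewrite -grade1_ext grade_eq0 // eqxx.
  pose n : N := SigSub (mem_set (cx : hom_kernel c x)).
  exists n => //; apply: subset_closure => /=.
  by rewrite -(res_ext f).
Qed.

(** The kernel is closed, so [C] meets it in a compact set; a cluster point found there is also one
    for the subspace topology. *)
Lemma compact_val_preimage (C : set Q) : compact C ->
  compact ((fun n : N => val n) @^-1` C).
Proof.
move=> cC F FF FC.
have [p [[Cp cp] clp]] : (C `&` hom_kernel c) `&` cluster (val n @[n --> F]) !=set0.
  have cCN : compact (C `&` hom_kernel c).
    apply: (subclosed_compact _ cC); last by move=> ? [].
    apply: closedI; last exact: closed_degree.
    exact: compact_closed.
  apply: cCN; rewrite /= nbhs_filterE.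
  apply: (filterS _ FC) => n Cn; split=> //; exact: set_valP.
pose n : N := SigSub (mem_set cp).
exists n; split=> // A B FA; rewrite nbhsE => -[_ [[V oV <-] Vn] VB].
have FvA : F ((fun n : N => val n) @^-1` (val @` A)).
  by apply: filterS FA => m Am; exists m.
have [_ [[m Am <-] Vm]] := clp _ V FvA (open_nbhs_nbhs (conj oV Vn)).
by exists m; split=> //; exact: VB.
Qed.

Lemma Cc_res k : Cc R Q k -> Cc R N (res k).
Proof.
move=> [ck kk]; split.
  exact: (continuous_compose (@val_continuous _ _) ck).
have cC := compact_val_preimage kk.
apply: subclosed_compact cC _; first exact: closed_closure.
have clC : closed ((fun n : N => val n) @^-1` csupp k).
  apply: closed_comp (@closed_closure _ _) => n _; exact: val_continuous.
rewrite [X in _ `<=` X](closure_id _).1 //; apply: closureS => n h.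
exact: (@csupp_ne0 _ _ k (val n) h).
Qed.

End Topology.

End KernelFunctions.

(** * The form induced by a representation of the kernel *)

Section InducedForm.
Variables (R : realType) (Q : groupoid) (G : groupType) (c : Q -> G).
Hypotheses (Q_T2 : hausdorff_space Q) (Q_lc : locally_compact [set: Q]).
Hypothesis Q_rd : r_discrete Q.
Hypothesis c_cont : continuous (c : Q -> discrete_topology G).
Hypothesis c_hom : groupoid_hom c.
Local Notation K := R[i].
Local Notation N := (kernel_groupoid c_hom).
Local Notation resN := (@res R Q G c c_hom).
Local Notation CcQ := (Cc R Q).
Variables (H : hilbert R) (pi : (N -> K^o) -> H -> H).
Hypothesis pi_rep : Cc_rep pi.
Variable xi : H.
Implicit Types (a b k : Q -> K^o) (x y : Q) (l : K).

Definition vector_functional a : K := inner (pi (resN a) xi) xi.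
Local Notation phi := vector_functional.

Let ffQ a : CcQ a -> finite_fibers a.
Proof. exact: Cc_finite_fibers. Qed.

Let CcN a : CcQ a -> Cc R N (resN a).
Proof. exact: Cc_res. Qed.

Let CcI a : CcQ a -> CcQ (invol a).
Proof. exact: Cc_invol. Qed.

Let CcM a b : CcQ a -> CcQ b -> CcQ (convolution a b).
Proof. exact: Cc_convolution. Qed.

Lemma vector_functional_linear l a b : CcQ a -> CcQ b ->
  phi (fun x => l * a x + b x) = l * phi a + phi b.
Proof.
move=> ca cb; rewrite /phi -inner_linear.
by rewrite -(rep_linear pi_rep l (CcN ca) (CcN cb)).
Qed.

Lemma vector_functional0 : phi (fun=> 0) = 0.
Proof.
have c0 := Cc0 R Q_T2; have := vector_functional_linear (-1) c0 c0.
rewrite (_ : (fun x => _) = fun=> 0).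
  by move=> ->; rewrite mulN1r addNr.
by apply/funext => x; rewrite mulr0 addr0.
Qed.

Lemma vector_functional_grade1 a b : grade c 1%g a = grade c 1%g b -> phi a = phi b.
Proof. by rewrite /phi => e; rewrite -res_grade1 e res_grade1. Qed.

Lemma vector_functional_invol a : CcQ a -> phi (invol a) = (phi a)^*.
Proof.
move=> ca; rewrite /vector_functional -innerC (rep_invol pi_rep (CcN (CcI ca))).
by rewrite res_invol involK.
Qed.

Lemma vector_functional_square a : CcQ a ->
  phi (convolution (invol (grade c 1%g a)) (grade c 1%g a)) = `|pi (resN a) xi| ^+ 2.
Proof.
move=> ca; have cr := CcN ca; have ci := CcN (CcI ca).
have -> : phi (convolution (invol (grade c 1%g a)) (grade c 1%g a)) =
    inner (pi (convolution (invol (resN a)) (resN a)) xi) xi.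
  by rewrite /vector_functional kernel_convolution ext_invol ext_res.
rewrite res_invol in ci; rewrite (rep_conv pi_rep) // (rep_invol pi_rep) // involK.
exact: inner_norm.
Qed.

Lemma vector_functional_convolution_linearr l a b b' : CcQ a -> CcQ b -> CcQ b' ->
  phi (convolution a (fun x => l * b x + b' x)) =
  l * phi (convolution a b) + phi (convolution a b').
Proof.
move=> ca cb cb'; rewrite -vector_functional_linear; [|exact: CcM|exact: CcM].
by congr phi; apply/funext => x; apply: convolution_linearr; exact: ffQ.
Qed.

Lemma vector_functional_convolution_sum (I : Type) (s : seq I) a
    (F : I -> Q -> K^o) : CcQ a ->
  (forall i, CcQ (F i)) ->
  phi (convolution a (fun x => \sum_(i <- s) F i x)) =
  \sum_(i <- s) phi (convolution a (F i)).
Proof.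
move=> ca cF.
suff : CcQ (fun x => \sum_(i <- s) F i x) /\
  phi (convolution a (fun x => \sum_(i <- s) F i x)) =
  \sum_(i <- s) phi (convolution a (F i)) by case.
elim: s => [|i s [cs IHs]].
  rewrite big_nil (_ : (fun x => _) = fun=> 0); last by apply/funext => x; rewrite big_nil.
  split; first exact: Cc0.
  rewrite (_ : convolution _ _ = fun=> 0); first exact: vector_functional0.
  by apply/funext => x; apply: fsbig1 => y _; rewrite mulr0.
rewrite big_cons -IHs (_ : (fun x => _) = fun x => F i x + \sum_(j <- s) F j x); last first.
  by apply/funext => x; rewrite big_cons.
split; first exact: Cc_add.
rewrite -[X in _ = X + _]mul1r -vector_functional_convolution_linearr //.
by congr (phi (convolution _ _)); apply/funext => x; rewrite mul1r.
Qed.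

(** Mere inclusion in an r-section is asked for, so that an r-section can be cut down to one degree
    without checking again that its image is open. *)
Definition homogeneous_section : set (set Q) :=
  [set U | (exists2 U0, r_section U0 & U `<=` U0) /\
           exists g, forall x, U x -> c x = g].

Lemma homogeneous_section_cover x :
  exists U, [/\ homogeneous_section U, open U & U x].
Proof.
have [U [sU oU Ux]] := r_section_cover Q_rd x.
exists (U `&` c @^-1` [set c x]); split=> //.
- split; first by exists U => // y [].
  by exists (c x) => y [].
- by apply: openI => //; exact: open_degree.
Qed.

(** The root is taken of the real part so that its continuity reduces to that of the real square
    root. *)
Lemma real_sqrt_sqr (r : K) : 0 <= r ->
  (Num.sqrt (complex.Re r))%:C%C ^+ 2 = r.
Proof.
move=> r0; have r0' : 0 <= complex.Re r by move: r0; rewrite lecE => /andP[].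
by rewrite -rmorphXn /= sqr_sqrtr // RRe_real // ger0_real.
Qed.

Lemma conjC_realC (r : R) : (r%:C%C)^* = r%:C%C :> K.
Proof. exact: conjc_real. Qed.

Lemma sqrt_Re_continuous (E : Q -> K^o) : continuous E ->
  continuous (fun x => (Num.sqrt (complex.Re (E x)))%:C%C : K^o).
Proof.
move=> cE; apply: (@continuous_real_complex R Q).
exact: (continuous_compose (continuous_Re cE) (@sqrt_continuous R)).
Qed.

(* For homogeneous sections [h], the element [h k] restricts to the kernel as
   [h] times one component of [k], so [k* h* h k] is a square over the kernel;
   [k* k] is a sum of such squares once [k] is divided by the square root of the
   total weight of a finite family of sections covering its support. *)
Lemma vector_functional_positive k : CcQ k -> 0 <= phi (convolution (invol k) k).
Proof.
move=> ck.
have [u [hu cover_u]] := @bump_family R Q Q_T2 Q_lc _ homogeneous_section_cover.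
(* The weight of [u x] is positive at [y] as soon as [u x] is nonzero at [y^-1], so it is the
   inverse of the support that must be covered. *)
have [|s hs] := cover_u (@ginv Q @` csupp k).
  apply: continuous_compact (Cc_supp ck); apply: continuous_subspaceT.
  exact: ginv_continuous.
have uC x : CcQ (u x) by have [] := hu x.
have [U0 sU0 uU0] : exists2 U0 : Q -> set Q, (forall x, r_section (U0 x)) &
    forall x, csupp (u x) `<=` U0 x.
  have h x : exists U, r_section U /\ csupp (u x) `<=` U.
    have [_ _ [U [[U' sU' UU'] _] uU]] := hu x.
    by exists U'; split=> //; exact: subset_trans uU UU'.
  have [U' hU'] := choice h.
  by exists U' => x; have [] := hU' x.
have deg x : exists g, forall y, u x y != 0 -> c y = g.
  have [_ _ [U [_ [g gU]] uU]] := hu x.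
  by exists g => y uy; apply/gU/uU/csupp_ne0.
have [g gP] := choice deg.
pose D x := fiber_weight (u x).
have D0 x y : 0 <= D x y := fiber_weight_ge0 Q_T2 Q_lc Q_rd (uC x) y.
(* The degree-one part of [u x * k'] sees only the component of [k'] of degree [(g x)^-1], so the
   weight of [u x] counts in that degree alone. *)
pose E y := \sum_(x <- s) grade c (g x)^-1%g (D x) y.
have gD0 x y : 0 <= grade c (g x)^-1%g (D x) y.
  by rewrite /grade; case: ifP => // _; exact: D0.
have E0 y : 0 <= E y by apply: sumr_ge0.
have cE : continuous E.
  rewrite /E; elim: s {hs E E0} => [|x s IHs].
    by under eq_fun do rewrite big_nil; move=> y; exact: cvg_cst.
  under eq_fun do rewrite big_cons; move=> y; apply: (@cvgD _ K^o); last exact: IHs.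
  apply: (grade_continuous c_cont).
  exact: fiber_weight_continuous.
have Epos y : csupp k y -> 0 < E y.
  move=> ky; have [x xs uxy] := hs _ (imageP _ ky).
  rewrite /E (big_rem x) //= ltr_pwDl ?sumr_ge0 // grade_id.
    exact: fiber_weight_gt0.
  by rewrite -(gP _ _ uxy) (c_ginv c_hom) invgK.
pose e y : K := (Num.sqrt (complex.Re (E y)))%:C%C.
have eE y : e y ^+ 2 = E y by exact: real_sqrt_sqr.
have ce : continuous (e : Q -> K^o) by exact: sqrt_Re_continuous.
have ene y : csupp k y -> e y != 0.
  by move=> /Epos; rewrite -eE; apply: contraTneq => ->; rewrite expr0n ltxx.
pose k' : Q -> K^o := fun y => k y / e y.
have ck' : CcQ k' by exact: Cc_div.
have kE : k = (fun y => e y * k' y).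
  apply/funext => y; have [ky|/csupp_eq0 ky] := pselect (csupp k y).
    by rewrite mulrC divfK // ene.
  by rewrite /k' ky mul0r mulr0.
have e_radial y z : grange y = grange z -> c y = c z -> e y = e z.
  move=> yz cyz; congr (Num.sqrt (complex.Re _))%:C%C; apply: eq_bigr => x _.
  by rewrite /grade cyz /D (fiber_weight_range _ yz).
pose h x := convolution (u x) k'.
have ch x : CcQ (h x) by exact: CcM.
(* By homogeneity the degree-one part of [h x] is [u x] times one component of [k']; multiplying by
   [(u x)^*] produces the weight [D x] on that component. *)
have term x : phi (convolution (invol k') (fun y => grade c (g x)^-1%g (D x) y * k' y)) =
    `|pi (resN (h x)) xi| ^+ 2.
  rewrite -vector_functional_square //.
  have -> : (fun y => grade c (g x)^-1%g (D x) y * k' y) =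
      convolution (invol (u x)) (grade c 1%g (h x)).
    rewrite (grade1_convolution c_hom _ (gP x)).
    rewrite (section_multiplier Q_T2 Q_lc Q_rd (uC x) (sU0 x) (uU0 x)).
    by apply/funext => y; rewrite /grade; case: ifP; rewrite // mulr0 mul0r.
  rewrite -convolutionA; [|exact/ffQ/CcI|exact/ffQ/CcI].
  rewrite -invol_convolution; last exact: ffQ.
  apply: vector_functional_grade1.
  rewrite (grade1_convr c_hom) (grade1_invol c_hom).
  by rewrite (grade1_convr c_hom) (grade1_invol c_hom) grade_idem.
(* One factor [e] crosses from the left argument to the right; with the [e] contained in [k] it
   makes [e^2 = E], which splits as a sum. *)
rewrite {1}kE (@vector_functional_grade1 _
  (convolution (invol k') (fun y => (e y)^* * k y))); last first.
  exact: grade1_radial.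
have -> : (fun y => (e y)^* * k y) =
    (fun y => \sum_(x <- s) grade c (g x)^-1%g (D x) y * k' y).
  apply/funext => y; rewrite -mulr_suml -/(E y) -eE conjC_realC {1}kE.
  by rewrite mulrA -expr2.
rewrite vector_functional_convolution_sum.
- by apply: sumr_ge0 => x _; rewrite term exprn_ge0.
- exact: CcI.
move=> x; rewrite (_ : (fun y => _) = fun y => k' y * grade c (g x)^-1%g (D x) y).
  apply: (Cc_mulr Q_T2 ck'); apply: (grade_continuous c_cont).
  exact: fiber_weight_continuous.
by apply/funext => y; rewrite mulrC.
Qed.

End InducedForm.

Section InducedRepresentation.
Variables (R : realType) (Q : groupoid) (G : groupType) (c : Q -> G).
Hypotheses (Q_T2 : hausdorff_space Q) (Q_lc : locally_compact [set: Q]).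
Hypothesis Q_rd : r_discrete Q.
Hypothesis c_cont : continuous (c : Q -> discrete_topology G).
Hypothesis c_hom : groupoid_hom c.
Local Notation K := R[i].
Local Notation N := (kernel_groupoid c_hom).
Local Notation resN := (@res R Q G c c_hom).
Local Notation CcQ := (Cc R Q).
Variables (H : hilbert R) (pi : (N -> K^o) -> H -> H).
Hypothesis pi_rep : Cc_rep pi.
Variable xi : H.
Implicit Types (a b k : Q -> K^o) (x y : Q) (l : K).
Local Notation phi := (vector_functional pi xi).

Definition induced_space := {k : Q -> K^o | CcQ k}.
Implicit Types (u v w : induced_space).

Let CcI a : CcQ a -> CcQ (invol a).
Proof. exact: Cc_invol. Qed.

Let CcM a b : CcQ a -> CcQ b -> CcQ (convolution a b).
Proof. exact: Cc_convolution. Qed.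

Let ffQ a : CcQ a -> finite_fibers a.
Proof. exact: Cc_finite_fibers. Qed.

Definition induced_lin l u v : induced_space :=
  exist _ _ (Cc_lin Q_T2 l (svalP u) (svalP v)).

Definition induced_dot u v : K := phi (convolution (invol (sval v)) (sval u)).

Lemma induced_dot_linear l u v w :
  induced_dot (induced_lin l u v) w = l * induced_dot u w + induced_dot v w.
Proof.
apply: vector_functional_convolution_linearr => //; try exact: svalP.
by apply: CcI; exact: svalP.
Qed.

Lemma induced_dotC u v : induced_dot v u = (induced_dot u v)^*.
Proof.
have cu := svalP u; have cv := svalP v.
rewrite /induced_dot -vector_functional_invol //; last by apply: CcM => //; exact: CcI.
by rewrite invol_convolution ?involK //; exact/ffQ/CcI.
Qed.

Lemma induced_dot_ge0 u : 0 <= induced_dot u u.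
Proof. by apply: vector_functional_positive => //; exact: svalP. Qed.

Definition induced_prehilbert : prehilbert R :=
  @Prehilbert R induced_space (exist _ _ (Cc0 R Q_T2)) induced_lin induced_dot
    induced_dot_linear induced_dotC induced_dot_ge0.
Local Notation X := induced_prehilbert.

Definition act a u : induced_space :=
  if pselect (CcQ a) is left ca then exist _ _ (CcM ca (svalP u)) else u.

Lemma act_val a u : CcQ a -> sval (act a u) = convolution a (sval u).
Proof. by rewrite /act; case: pselect. Qed.

Lemma induced_eq u v : sval u = sval v -> u = v.
Proof.
case: u v => [u cu] [v cv] /= uv; subst v; congr exist; exact: Prop_irrelevance.
Qed.

Lemma act_adjoint a u v : CcQ a ->
  induced_dot (act a u) v = induced_dot u (act (invol a) v).
Proof.
move=> ca; have ci := CcI ca; have cv := svalP v.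
rewrite /induced_dot !act_val // invol_convolution; last exact: ffQ.
by rewrite involK convolutionA //; [exact/ffQ/CcI|exact: ffQ].
Qed.

(** Bounds add, so [a] may be supported in an r-section. Then [a^* a] multiplies by the weight
    [D <= M], and [M - D = r^2] with [r] a function of the range. Hence
    [M <k, k> - <a k, a k> = <r k, r k>], which is nonnegative. *)
Lemma act_bounded a : CcQ a ->
  exists2 M : K, 0 <= M & forall u : X, dnorm (act a u : X) <= M * dnorm u.
Proof.
move: a; apply: (Cc_local_ind Q_T2 Q_lc (r_section_cover Q_rd)).
- exists 0 => // u; rewrite mul0r; have c0 := Cc0 R Q_T2.
  rewrite /dnorm /= /induced_dot !act_val //.
  rewrite (_ : convolution (fun=> 0) _ = fun=> 0); last first.
    by apply/funext => x; apply: fsbig1 => y _; rewrite mul0r.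
  rewrite (_ : convolution _ _ = fun=> 0).
    by rewrite (vector_functional0 Q_T2 c_cont pi_rep) sqrtC0.
  by apply/funext => x; apply: fsbig1 => y _; rewrite mulr0.
- move=> a b ca cb [M M0 aM] [L L0 bL].
  exists (M + L) => [|u]; first exact: addr_ge0.
  have -> : act (fun x => a x + b x) u = induced_lin 1 (act a u) (act b u).
    apply: induced_eq; rewrite /= !act_val //; last exact: Cc_add.
    apply/funext => x; rewrite -convolution_linearl; [|exact: ffQ|exact: ffQ].
    rewrite (_ : (fun y => 1 * a y + b y) = fun y => a y + b y) //.
    by apply/funext => y; rewrite mul1r.
  apply: le_trans (dnormZD _ _ _) _.
  by rewrite normr1 mul1r mulrDl lerD.
- move=> a U ca sU aU.
  have [M M0 aM] := fiber_weight_bounded Q_T2 Q_lc Q_rd ca.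
  pose D := fiber_weight a.
  have D0 x : 0 <= D x by exact: fiber_weight_ge0.
  have cD : continuous D by exact: fiber_weight_continuous.
  have MD x : 0 <= M%:C%C - D x.
    by rewrite subr_ge0; apply: le_trans (aM x); rewrite ger0_norm // D0.
  have cMD : continuous (fun x => M%:C%C - D x : K^o).
    by move=> x; apply: (@cvgB _ K^o); [exact: cvg_cst|exact: cD].
  pose r x : K := (Num.sqrt (complex.Re (M%:C%C - D x)))%:C%C.
  have cr : continuous (r : Q -> K^o) by exact: sqrt_Re_continuous.
  have M0c : 0 <= M%:C%C :> K by rewrite ler0c.
  exists (sqrtC M%:C%C) => [|u]; first by rewrite sqrtC_ge0.
  have cu := svalP u; have ci := CcI cu.
  have s0 : 0 <= sqrtC M%:C%C :> K by rewrite sqrtC_ge0.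
  rewrite -ler_sqr ?nnegrE ?mulr_ge0 ?dnorm_ge0 //.
  rewrite exprMn !dnormK /= /induced_dot act_val //.
  set k := sval u in cu ci *.
  have cDk : CcQ (fun x => D x * k x) by exact: Cc_mull.
  have -> : convolution (invol (convolution a k)) (convolution a k) =
      convolution (invol k) (fun x => D x * k x).
    rewrite invol_convolution; last exact: ffQ.
    rewrite convolutionA; [|exact: ffQ|exact/ffQ/CcI].
    by rewrite (section_multiplier Q_T2 Q_lc Q_rd ca sU aU).
  have cMk : CcQ (fun x => M%:C%C * k x).
    by apply: (Cc_mull Q_T2 cu) => x; exact: cvg_cst.
  have crk : CcQ (fun x => r x * k x) by exact: Cc_mull.
  have := vector_functional_positive Q_T2 Q_lc Q_rd c_cont pi_rep xi crk.
  rewrite (@vector_functional_grade1 _ _ _ _ _ _ _ _ _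
    (convolution (invol k) (fun x => (r x)^* * (r x * k x)))).
    rewrite (_ : (fun x => (r x)^* * (r x * k x)) =
      fun x => (-1) * (D x * k x) + M%:C%C * k x).
      rewrite (vector_functional_convolution_linearr Q_T2 Q_lc Q_rd c_cont pi_rep xi
        (-1) ci cDk cMk).
      (* Linearity is available for combinations [l * b + b'] only, so [M k] is written as
         [(M - 1) k + k]. *)
      rewrite (_ : (fun x => M%:C%C * k x) = fun x => (M%:C%C - 1) * k x + k x); last first.
        by apply/funext => x; ring.
      rewrite (vector_functional_convolution_linearr Q_T2 Q_lc Q_rd c_cont pi_rep xi
        (M%:C%C - 1) ci cu cu).
      rewrite mulN1r mulrBl mul1r subrK addrC subr_ge0.
      by rewrite sqrtCK.
    apply/funext => x.
    rewrite conjC_realC mulrA -expr2 real_sqrt_sqr //; ring.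
  apply: grade1_radial => // y z yz _.
  by rewrite /r /D (fiber_weight_range _ yz).
Qed.

End InducedRepresentation.

(** * The induced representation *)

Section InducedStarRepresentation.
Variables (R : realType) (Q : groupoid) (G : groupType) (c : Q -> G).
Hypotheses (Q_T2 : hausdorff_space Q) (Q_lc : locally_compact [set: Q]).
Hypothesis Q_rd : r_discrete Q.
Hypothesis c_cont : continuous (c : Q -> discrete_topology G).
Hypothesis c_hom : groupoid_hom c.
Local Notation K := R[i].
Local Notation N := (kernel_groupoid c_hom).
Local Notation CcQ := (Cc R Q).
Variables (H : hilbert R) (pi : (N -> K^o) -> H -> H).
Hypothesis pi_rep : Cc_rep pi.
Variable xi : H.
Implicit Types (a b : Q -> K^o) (f g : N -> K^o).
Local Notation X := (induced_prehilbert Q_T2 Q_lc Q_rd c_cont pi_rep xi).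
Local Notation act := (act Q_T2 Q_lc Q_rd).

Let CcI a : CcQ a -> CcQ (invol a).
Proof. exact: Cc_invol. Qed.

Lemma act_invol_bounded a : CcQ a -> exists M : K, [/\ 0 <= M,
  forall u : X, dnorm (act a u : X) <= M * dnorm u &
  forall u : X, dnorm (act (invol a) u : X) <= M * dnorm u].
Proof.
move=> ca; have [M M0 aM] := act_bounded Q_T2 Q_lc Q_rd c_cont pi_rep xi ca.
have [L L0 aL] := act_bounded Q_T2 Q_lc Q_rd c_cont pi_rep xi (CcI ca).
exists (M + L); split=> [|u|u]; first exact: addr_ge0.
  by apply: le_trans (aM u) _; rewrite ler_wpM2r ?dnorm_ge0 // lerDl.
by apply: le_trans (aL u) _; rewrite ler_wpM2r ?dnorm_ge0 // lerDr.
Qed.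

Definition induced_rep a (F : completion_hilbert X) : completion_hilbert X :=
  precomp (X := X) (act (invol a)) F.

Lemma induced_repE a F u : CcQ a ->
  (induced_rep a F : completion X) u = (F : completion X) (act (invol a) u).
Proof.
move=> ca; have [M [M0 _ aM]] := act_invol_bounded ca.
apply: (precompE (X := X) M0 _ aM) => v w.
exact: act_adjoint.
Qed.

Lemma induced_rep_is_rep : Cc_rep induced_rep.
Proof.
split.
- move=> a ca l F F'; apply: completionP => u.
  by rewrite completion_linE !induced_repE // completion_linE.
- move=> a ca; have [M [M0 _ aM]] := act_invol_bounded ca.
  have MR : (complex.Re M)%:C%C = M by rewrite RRe_real // ger0_real.
  apply: (@le_lt_trans _ _ (complex.Re M)%:E); last exact: ltry.
  apply: opnorm_le => [|F]; first by rewrite -ler0c MR.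
  rewrite -lecR rmorphM /= -!rnormE MR.
  apply: (precomp_bounded (X := X) M0 _ aM) => v w.
  exact: act_adjoint.
- move=> l a b ca cb F; apply: completionP => u.
  rewrite completion_linE !induced_repE //; last exact: Cc_lin.
  have ci := CcI ca; have ci' := CcI cb.
  rewrite -[l in RHS]conjCK -completion_semilinear; congr (_ _).
  apply: induced_eq; rewrite /= !act_val //; last by apply: CcI; exact: Cc_lin.
  rewrite invol_linear; apply/funext => x.
  by apply: convolution_linearl; exact: Cc_finite_fibers.
- move=> a b ca cb F; apply: completionP => u.
  have ci := CcI ca; have ci' := CcI cb.
  have cab : CcQ (convolution a b) by exact: Cc_convolution.
  rewrite !induced_repE //; congr (_ _); apply: induced_eq.
  have := CcI cab; rewrite invol_convolution; last exact: Cc_finite_fibers.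
  move=> cba; rewrite !act_val // convolutionA //; exact: Cc_finite_fibers.
- move=> a ca F F'; have [M [M0 Ma aM]] := act_invol_bounded ca.
  apply: (@precomp_adjoint R X (act (invol a)) (act (invol (invol a))) M) => //.
  + by move=> v w; rewrite involK; exact: act_adjoint.
  + by move=> u; rewrite involK.
Qed.

Definition induced_vector f (cf : Cc R N f) : X :=
  exist _ (ext f) (Cc_ext Q_T2 c_cont cf).

(** On [C_c(N)] the form is [(pi(f) xi, pi(g) xi)], so the completion contains an isometric copy of
    [pi(C_c(N)) xi]. By [induced_rep_vector], the induced representation acts there as [pi] does. *)
Lemma norm_induced_vector f (cf : Cc R N f) :
  `|embed (induced_vector cf)| = `|pi f xi|.
Proof.
have p0 : 0 <= `|pi f xi| by [].
rewrite norm_embed -(sqrCK p0); congr sqrtC.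
have := vector_functional_square Q_T2 c_cont pi_rep xi (Cc_ext Q_T2 c_cont cf).
by rewrite grade1_ext res_ext.
Qed.

Lemma Cc_kernel_convolution f g : Cc R N f -> Cc R N g -> Cc R N (convolution f g).
Proof.
move=> cf cg; rewrite kernel_convolution; apply: Cc_res => //.
by apply: Cc_convolution => //; exact: Cc_ext.
Qed.

Lemma induced_rep_vector f g (cf : Cc R N f) (cg : Cc R N g)
    (cfg : Cc R N (convolution f g)) :
  induced_rep (ext f) (embed (induced_vector cg)) = embed (induced_vector cfg).
Proof.
have ce := Cc_ext Q_T2 c_cont cf.
have [M [M0 _ aM]] := act_invol_bounded ce.
rewrite /induced_rep (precomp_embed (X := X) (T := act (ext f)) M0 _ aM).
  by congr embed; apply: induced_eq; rewrite act_val //= -ext_convolution.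
by move=> v w; exact: act_adjoint.
Qed.

Lemma induced_rep_bound f g (C : R) : Cc R N f -> Cc R N g ->
  (opnorm (induced_rep (ext f)) <= C%:E)%E ->
  rnorm (pi f (pi g xi)) <= C * rnorm (pi g xi).
Proof.
move=> cf cg hC; have cfg := Cc_kernel_convolution cf cg.
have lin := rep_linear_op induced_rep_is_rep (Cc_ext Q_T2 c_cont cf).
have := opnorm_bound (embed (induced_vector cg)) lin hC.
rewrite (induced_rep_vector cf cg cfg) /rnorm !norm_induced_vector.
by rewrite (rep_conv pi_rep).
Qed.

End InducedStarRepresentation.

(** * Bounds for operators with an adjoint *)

Section HilbertSpace.
Variables (R : realType) (H : hilbert R).
Implicit Types x y z : H.

Lemma inner_ge0 x : 0 <= inner x x.
Proof. by rewrite inner_norm exprn_ge0. Qed.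

Definition hilbert_prehilbert : prehilbert R :=
  @Prehilbert R H 0 (fun l x y => l *: x + y) inner (@inner_linear R H)
    (@innerC R H) inner_ge0.

Lemma inner_cauchy_schwarz x y : `|inner x y| <= `|x| * `|y|.
Proof.
have nE z : `|z| = @dnorm R hilbert_prehilbert z.
  by rewrite /dnorm /= inner_norm sqrCK.
by rewrite !nE; exact: (@dot_cauchy_schwarz R hilbert_prehilbert).
Qed.

End HilbertSpace.

(* If [S] is the adjoint of [T] and [T] is [C]-Lipschitz on the range of [S],
   then [|S z|^2 = <z, T (S z)>] bounds [S], and then likewise [T]. *)
Lemma adjoint_bound (R : realType) (H : hilbert R) (T S : H -> H) (C : R) :
  0 <= C -> (forall x y, inner (T x) y = inner x (S y)) ->
  (forall z, rnorm (T (S z)) <= C * rnorm (S z)) ->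
  forall v, rnorm (T v) <= C * rnorm v.
Proof.
move=> C0 TS hC.
have hC' z : `|T (S z)| <= C%:C%C * `|S z|.
  by rewrite !rnormE -rmorphM lecR.
have C0' : 0 <= C%:C%C :> R[i] by rewrite ler0c.
have cancel (a b : R[i]) : 0 <= a -> 0 <= b -> a ^+ 2 <= b * a -> a <= b.
  move=> a0 b0; have [->|an0] := eqVneq a 0; first by [].
  by rewrite expr2 ler_pM2r // lt0r an0.
have Sb z : `|S z| <= C%:C%C * `|z|.
  apply: cancel => //; first by rewrite mulr_ge0.
  rewrite -inner_norm -TS -[leLHS]ger0_norm; last by rewrite TS inner_norm exprn_ge0.
  apply: le_trans (inner_cauchy_schwarz _ _) _.
  by rewrite mulrAC ler_wpM2r.
move=> v; rewrite -lecR rmorphM /= -!rnormE.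
apply: cancel => //; first by rewrite mulr_ge0.
rewrite -inner_norm TS -[leLHS]ger0_norm; last by rewrite -TS inner_norm exprn_ge0.
apply: le_trans (inner_cauchy_schwarz _ _) _.
by rewrite [leRHS]mulrAC [leRHS]mulrC ler_wpM2l.
Qed.

(** * Equality of norms and extension by density *)

Section NormEquality.
Variables (R : realType) (Q : groupoid) (G : groupType) (c : Q -> G).
Hypotheses (Q_T2 : hausdorff_space Q) (Q_lc : locally_compact [set: Q]).
Hypothesis Q_rd : r_discrete Q.
Hypothesis c_cont : continuous (c : Q -> discrete_topology G).
Hypothesis c_hom : groupoid_hom c.
Local Notation K := R[i].
Local Notation N := (kernel_groupoid c_hom).
Implicit Types (f g : N -> K^o).

Lemma Cc_kernel_invol f : Cc R N f -> Cc R N (invol f).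
Proof.
move=> cf; rewrite -(res_ext f) -res_invol; apply: Cc_res => //.
by apply: Cc_invol => //; exact: Cc_ext.
Qed.

Lemma restrict_rep (H : hilbert R) (rho : (Q -> K^o) -> H -> H) :
  Cc_rep rho -> Cc_rep (fun f : N -> K^o => rho (ext f)).
Proof.
move=> rr; have ce f := Cc_ext Q_T2 c_cont (f := f); split.
- by move=> f /ce; exact: rep_linear_op.
- by move=> f /ce; exact: rep_bounded_op.
- move=> l f g /ce cf /ce cg xi; rewrite ext_linear; exact: rep_linear.
- move=> f g /ce cf /ce cg xi; rewrite ext_convolution; exact: rep_conv.
- move=> f /ce cf xi eta; rewrite ext_invol; exact: rep_invol.
Qed.

Lemma kernel_rep_bound (H : hilbert R) (pi : (N -> K^o) -> H -> H) f (C : R) :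
  Cc_rep pi -> Cc R N f -> 0 <= C ->
  (ereal_sup (rep_norms (ext f)) <= C%:E)%E -> (opnorm (pi f) <= C%:E)%E.
Proof.
move=> pr cf C0 hC; apply: opnorm_le => //.
apply: (adjoint_bound (S := pi (invol f))) => [//|x y|z].
  exact: (rep_invol pr).
(* Every [z] gets an induced representation of its own; the supremum over all representations of
   [C_c(Q)] bounds them uniformly. *)
apply: (induced_rep_bound (xi := z) (Q_lc := Q_lc) (Q_rd := Q_rd)
  (pi_rep := pr) cf (Cc_kernel_invol cf)).
apply: le_trans hC; apply: ereal_sup_ubound.
exists (completion_hilbert (induced_prehilbert Q_T2 Q_lc Q_rd c_cont pr z)).
by exists (@induced_rep _ _ _ _ Q_T2 Q_lc Q_rd c_cont _ _ _ pr z); split=> //;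
  exact: induced_rep_is_rep.
Qed.

(** Inducing gives one inequality and makes the canonical map faithful; restricting representations
    of [C_c(Q)] to [C_c(N)] gives the other and makes the map exist. *)
Lemma ext_norm (A B : cstarAlgebra R) (iotaN : (N -> K^o) -> A)
    (iotaQ : (Q -> K^o) -> B) f :
  groupoid_Cstar iotaN -> groupoid_Cstar iotaQ -> Cc R N f ->
  `|iotaN f| = `|iotaQ (ext f)|.
Proof.
move=> CN CQ cf; have ce := Cc_ext Q_T2 c_cont cf.
have nN := Cstar_norm CN cf; have nQ := Cstar_norm CQ ce.
rewrite !rnormE; congr (_)%:C%C; apply/le_anti/andP; split; rewrite -lee_fin.
  rewrite nN; apply: ge_ereal_sup => _ [H [pi [pr ->]]].
  by apply: kernel_rep_bound; rewrite ?nQ ?rnorm_ge0.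
rewrite nQ; apply: ge_ereal_sup => _ [H [rho [rr ->]]].
rewrite nN; apply: ereal_sup_ubound; exists H, (fun f : N -> K^o => rho (ext f)).
by split=> //; exact: restrict_rep.
Qed.

End NormEquality.

(* The isometry of [p f] onto [q f] extends to the closure of the image of
   [p]: [extension a] is the unique point as close to each [q f] as [a] is to
   [p f]. *)
Section IsometricExtension.
Variables (R : realType) (A B : completeNormedModType R[i]).
Local Notation K := R[i].
Variables (F : Type) (p : F -> A) (q : F -> B).
Hypothesis pq : forall f g, `|p f - p g| = `|q f - q g|.
Hypothesis p_dense : closure (range p) = setT.

Lemma dense_near (a : A) (e : K) : 0 < e -> exists f, `|a - p f| < e.
Proof.
move=> e0; have : closure (range p) a by rewrite p_dense.
move=> /(_ _ (nbhsx_ballx a e e0))[_ [[f _ <-]]].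
by rewrite -ball_normE => h; exists f.
Qed.

Lemma extension_exists (a : A) : exists b : B, forall f, `|b - q f| <= `|a - p f|.
Proof.
have iv n : 0 < n.+1%:R^-1 :> K by rewrite invr_gt0 ltr0n.
have [f fa] := choice (fun n => dense_near a (iv n)).
have near_q g n : `|q (f n) - q g| <= n.+1%:R^-1 + `|a - p g|.
  rewrite -pq; apply: le_trans (ler_distD a _ _) _.
  by rewrite lerD2r distrC ltW.
have inv0 : n.+1%:R^-1 @[n --> \oo] --> (0 : K^o).
  apply/cvgrPdist_lt => e e0; have [n ne] := invSn_small e0.
  exists n => // m nm; rewrite sub0r normrN gtr0_norm //.
  by apply: le_lt_trans ne; rewrite lef_pV2 ?posrE ?ltr0n // ler_nat ltnS.
have /cvg_ex[b qb] : cvg (q (f n) @[n --> \oo]).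
  apply/cauchy_cvgP; apply: cauchy_exP => e e0.
  have e2 : 0 < e / 2 by rewrite divr_gt0.
  have [n ne] := invSn_small e2.
  exists (q (f n)), n => // m /= nm; rewrite -ball_normE /=.
  apply: le_lt_trans (near_q _ _) _; rewrite [e]splitr ltrD //.
  apply: lt_trans (fa m) _; apply: le_lt_trans ne.
  by rewrite lef_pV2 ?posrE ?ltr0n // ler_nat ltnS.
exists b => g.
apply: (@ler_mul_addgt0 _ _ _ 2) => // e e0.
have /cvgrPdist_lt/(_ _ e0)[n1 _ h1] := qb.
have /cvgrPdist_lt/(_ _ e0)[n2 _ h2] := inv0.
pose n := maxn n1 n2.
have bn := h1 n (leq_maxl _ _); have := h2 n (leq_maxr _ _).
rewrite sub0r normrN gtr0_norm // => ne.
apply: le_trans (ler_distD (q (f n)) _ _) _.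
apply: le_trans (lerD (ltW bn) (near_q g n)) _.
rewrite addrA addrC lerD2l mulr2n mulrDl mul1r lerD2l.
exact: ltW.
Qed.

Definition extension (a : A) : B := projT1 (cid (extension_exists a)).

Lemma extensionP a f : `|extension a - q f| <= `|a - p f|.
Proof. exact: (projT2 (cid (extension_exists a))). Qed.

(** The test for algebraic identities: one [f] must approximate both the argument and the expected
    value. The constant [k] is fixed in advance, and [e <= 1] leaves room for products. *)
Lemma extension_unique a (b : B) (k : K) : 0 <= k ->
  (forall e, 0 < e -> e <= 1 ->
    exists f, `|a - p f| <= k * e /\ `|b - q f| <= k * e) ->
  extension a = b.
Proof.
move=> k0 h; apply/eqP; rewrite -subr_eq0; apply/eqP.
apply: (@norm_le_small0 _ _ _ (k + k)) =>
  [|e e0 /(h _ e0)[f [af bf]]]; first exact: addr_ge0.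
apply: le_trans (ler_distD (q f) _ _) _; rewrite mulrDl lerD //.
  exact: le_trans (extensionP a f) af.
by rewrite distrC.
Qed.

Lemma extension_p f : extension (p f) = q f.
Proof.
by apply: (@extension_unique _ _ 0) => // e _ _; exists f; rewrite !subrr !normr0 mul0r.
Qed.

Lemma extension_isometry a a' : `|extension a - extension a'| = `|a - a'|.
Proof.
(* Four errors of size [e] occur: [a] and [a'] against their approximants, and likewise their
   images. *)
have k4 : 0 <= 4 :> K by [].
have near e : 0 < e -> exists f, [/\ `|a - p f| <= e & `|extension a - q f| <= e].
  move=> /(dense_near a)[f /ltW fa]; exists f; split=> //.
  exact: le_trans (extensionP a f) fa.
have near' e : 0 < e -> exists f, [/\ `|a' - p f| <= e & `|extension a' - q f| <= e].
  move=> /(dense_near a')[f /ltW fa]; exists f; split=> //.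
  exact: le_trans (extensionP a' f) fa.
apply/le_anti/andP; split; apply: (ler_mul_addgt0 k4) => e e0;
  have [f [af bf]] := near e e0; have [g [ag bg]] := near' e e0.
- apply: le_trans (ler_distD (q f) _ _) _.
  apply: le_trans (lerD bf (ler_distD (q g) _ _)) _.
  rewrite [`|q g - _|]distrC -pq.
  apply: le_trans (lerD (lexx _) (lerD (ler_distD a _ _) bg)) _.
  rewrite [`|p f - a|]distrC.
  apply: le_trans (lerD (lexx _) (lerD (lerD af (ler_distD a' _ _)) (lexx _))) _.
  apply: le_trans (lerD (lexx _) (lerD (lerD (lexx _) (lerD (lexx _) ag)) (lexx _))) _.
  by rewrite le_eqVlt; apply/orP; left; apply/eqP; ring.
- apply: le_trans (ler_distD (p f) _ _) _.
  apply: le_trans (lerD af (ler_distD (p g) _ _)) _.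
  rewrite [`|p g - _|]distrC pq.
  apply: le_trans (lerD (lexx _) (lerD (ler_distD (extension a) _ _) ag)) _.
  rewrite [`|q f - _|]distrC.
  apply: le_trans (lerD (lexx _) (lerD (lerD bf (ler_distD (extension a') _ _)) (lexx _))) _.
  apply: le_trans (lerD (lexx _) (lerD (lerD (lexx _) (lerD (lexx _) bg)) (lexx _))) _.
  by rewrite le_eqVlt; apply/orP; left; apply/eqP; ring.
Qed.

Lemma extension_inj : injective extension.
Proof.
move=> a a' e; apply/eqP; rewrite -subr_eq0 -normr_eq0 -extension_isometry e.
by rewrite subrr normr0.
Qed.

Lemma extension_continuous : continuous extension.
Proof.
move=> a; apply/cvgrPdist_lt => e e0; near=> x.
by rewrite extension_isometry; near: x; exact: cvgr_dist_lt.
Unshelve. all: by end_near. Qed.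

End IsometricExtension.

Section CstarAlgebra.
Variables (R : realType) (A : cstarAlgebra R).
Implicit Types a b d : A.

Lemma cmulBl a b d : cmul (a - b) d = cmul a d - cmul b d.
Proof.
by rewrite addrC -scaleN1r cmul_linearl scaleN1r addrC.
Qed.

Lemma cmulBr a b d : cmul a (b - d) = cmul a b - cmul a d.
Proof.
by rewrite addrC -scaleN1r cmul_linearr scaleN1r addrC.
Qed.

Lemma cstarB a b : cstar (a - b) = cstar a - cstar b.
Proof.
by rewrite addrC -scaleN1r cstar_antilinear rmorphN rmorph1 scaleN1r addrC.
Qed.

Lemma cstar_norm a : `|cstar a| = `|a|.
Proof.
have le b : `|b| <= `|cstar b|.
  have [->|bn0] := eqVneq b 0; first by rewrite normr0.
  have b0 : 0 < `|b| by rewrite normr_gt0.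
  rewrite -(ler_pM2r b0) -expr2 -cnorm_star; exact: cnormM.
by apply/le_anti; rewrite le -{2}[a]cstarK le.
Qed.

Lemma cmul_dist a b a' b' : `|cmul a b - cmul a' b'| <=
  `|a| * `|b - b'| + `|a - a'| * `|b'|.
Proof.
apply: le_trans (ler_distD (cmul a b') _ _) _.
by rewrite -cmulBr -cmulBl lerD ?cnormM.
Qed.

End CstarAlgebra.

(** * The canonical map on the completed algebras *)

Section CanonicalMap.
Variables (R : realType) (Q : groupoid) (G : groupType) (c : Q -> G).
Hypotheses (Q_T2 : hausdorff_space Q) (Q_lc : locally_compact [set: Q]).
Hypothesis Q_rd : r_discrete Q.
Hypothesis c_cont : continuous (c : Q -> discrete_topology G).
Hypothesis c_hom : groupoid_hom c.
Local Notation K := R[i].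
Local Notation N := (kernel_groupoid c_hom).
Variables (A B : cstarAlgebra R) (iotaN : (N -> K^o) -> A).
Variable (iotaQ : (Q -> K^o) -> B).
Hypotheses (CN : groupoid_Cstar iotaN) (CQ : groupoid_Cstar iotaQ).
Implicit Types (f g : N -> K^o).

Lemma Cc_kernel_lin (l : K) f g : Cc R N f -> Cc R N g ->
  Cc R N (fun x => l * f x + g x).
Proof.
move=> cf cg; rewrite -(res_ext (fun x => _)) ext_linear; apply: Cc_res => //.
by apply: Cc_lin => //; exact: Cc_ext.
Qed.

Definition Cc_kernel := {f : N -> K^o | Cc R N f}.
Implicit Types u v : Cc_kernel.

Definition kernel_in u : A := iotaN (sval u).
Definition kernel_out u : B := iotaQ (ext (sval u)).

Let ce f : Cc R N f -> Cc R Q (ext f).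
Proof. exact: Cc_ext. Qed.

(** A single [w] serves in both algebras, as [extension_unique] requires; the same holds for
    products and adjoints below. *)
Lemma kernel_lin (l : K) u v : exists w,
  kernel_in w = l *: kernel_in u + kernel_in v /\
  kernel_out w = l *: kernel_out u + kernel_out v.
Proof.
have cu := svalP u; have cv := svalP v.
exists (exist _ _ (Cc_kernel_lin l cu cv)); split.
  exact: (Cc_hom_linear (Cstar_hom CN)).
rewrite /kernel_out /= ext_linear.
by apply: (Cc_hom_linear (Cstar_hom CQ)); exact: ce.
Qed.

Lemma kernel_mul u v : exists w,
  kernel_in w = cmul (kernel_in u) (kernel_in v) /\
  kernel_out w = cmul (kernel_out u) (kernel_out v).
Proof.
have cu := svalP u; have cv := svalP v.
exists (exist _ _ (Cc_kernel_convolution Q_T2 Q_lc Q_rd c_cont cu cv)); split.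
  exact: (Cc_hom_conv (Cstar_hom CN)).
rewrite /kernel_out /= ext_convolution.
by apply: (Cc_hom_conv (Cstar_hom CQ)); exact: ce.
Qed.

Lemma kernel_star u : exists w,
  kernel_in w = cstar (kernel_in u) /\ kernel_out w = cstar (kernel_out u).
Proof.
have cu := svalP u.
exists (exist _ _ (Cc_kernel_invol Q_T2 c_cont cu)); split.
  exact: (Cc_hom_invol (Cstar_hom CN)).
rewrite /kernel_out /= ext_invol.
by apply: (Cc_hom_invol (Cstar_hom CQ)); exact: ce.
Qed.

Lemma kernel_isometry u v : `|kernel_in u - kernel_in v| = `|kernel_out u - kernel_out v|.
Proof.
have [w [wN wQ]] := kernel_lin (-1) v u.
rewrite scaleN1r addrC in wN; rewrite scaleN1r addrC in wQ.
rewrite -wN -wQ.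
exact: (ext_norm Q_T2 Q_lc Q_rd c_cont CN CQ (svalP w)).
Qed.

Lemma kernel_in_dense : closure (range kernel_in) = setT.
Proof.
rewrite -(Cstar_dense CN); congr closure; apply/seteqP; split=> a.
  by move=> [u _ <-]; exists (sval u) => //; exact: svalP.
by move=> [f cf <-]; exists (exist _ f cf).
Qed.

Definition canonical_extension : A -> B := extension kernel_isometry kernel_in_dense.
Local Notation i := canonical_extension.

Lemma canonical_extension_near a e : 0 < e -> exists u,
  `|a - kernel_in u| <= e /\ `|i a - kernel_out u| <= e.
Proof.
move=> e0; have [u /ltW ua] := dense_near kernel_in_dense a e0.
by exists u; split=> //; exact: le_trans (extensionP _ _ _ _) ua.
Qed.

Lemma canonical_extension_linear : linear i.
Proof.
move=> l a b; have k0 : 0 <= `|l| + 1 by rewrite addr_ge0.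
apply: (extension_unique _ _ k0) => e e0 _.
have [u [au iu]] := canonical_extension_near a e0.
have [v [bv iv]] := canonical_extension_near b e0.
have [w [wN wQ]] := kernel_lin l u v.
have lin_dist (V : normedModType K) (x x' y y' : V) : `|x - x'| <= e -> `|y - y'| <= e ->
    `|l *: x + y - (l *: x' + y')| <= (`|l| + 1) * e.
  move=> xe ye; rewrite opprD addrACA -scalerBr mulrDl mul1r.
  apply: le_trans (ler_normD _ _) _; rewrite lerD // normrZ.
  by rewrite ler_wpM2l.
by exists w; rewrite wN wQ; split; exact: lin_dist.
Qed.

Lemma canonical_extension_mul a b : i (cmul a b) = cmul (i a) (i b).
Proof.
(* The sum of the constants for the two algebras. Each [+ 1] bounds the norm of an approximant of
   the second factor, which is off by at most [e <= 1]. *)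
pose k := `|a| + (`|b| + 1) + (`|i a| + (`|i b| + 1)).
have k0 : 0 <= k by rewrite !addr_ge0.
apply: (extension_unique _ _ k0) => e e0 e1.
have [u [au iu]] := canonical_extension_near a e0.
have [v [bv iv]] := canonical_extension_near b e0.
have [w [wN wQ]] := kernel_mul u v.
have mul_dist (D : cstarAlgebra R) (x x' y y' : D) :
    `|x - x'| <= e -> `|y - y'| <= e ->
    `|cmul x y - cmul x' y'| <= (`|x| + (`|y| + 1)) * e.
  move=> xe ye; apply: le_trans (cmul_dist _ _ _ _) _; rewrite mulrDl lerD //.
    by rewrite ler_wpM2l.
  rewrite mulrC ler_pM // -[y'](subrKC y); apply: le_trans (ler_normD _ _) _.
  by rewrite lerD2l distrC; exact: le_trans e1.
exists w; rewrite wN wQ /k; split.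
  apply: le_trans (mul_dist _ _ _ _ _ au bv) _; rewrite ler_wpM2r ?(ltW e0) //.
  by rewrite lerDl !addr_ge0.
apply: le_trans (mul_dist _ _ _ _ _ iu iv) _; rewrite ler_wpM2r ?(ltW e0) //.
by rewrite lerDr !addr_ge0.
Qed.

Lemma canonical_extension_star a : i (cstar a) = cstar (i a).
Proof.
apply: (extension_unique _ _ ler01) => e e0 _.
have [u [au iu]] := canonical_extension_near a e0.
have [w [wN wQ]] := kernel_star u.
by exists w; rewrite wN wQ -!cstarB !cstar_norm mul1r.
Qed.

Lemma canonical_extension_map : canonical_map iotaN iotaQ i.
Proof.
split=> [|f cf]; last exact: (extension_p kernel_isometry kernel_in_dense (exist _ f cf)).
split.
- exact: canonical_extension_linear.
- exact: canonical_extension_mul.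
- exact: canonical_extension_star.
- exact: extension_continuous.
Qed.

Lemma canonical_map_unique j : canonical_map iotaN iotaQ j -> i = j.
Proof.
move=> [[_ _ _ cj] jf]; have [[_ _ _ ci] fi] := canonical_extension_map.
have cl : closed [set a | i a = j a].
  by apply: closed_equalizer => //; exact: norm_hausdorff.
apply/funext => a; apply: cl.
have : closure (iotaN @` Cc R N) a by rewrite (Cstar_dense CN).
by apply: closureS => _ [f cf <-]; rewrite /= fi // jf.
Qed.

End CanonicalMap.

Theorem theorem6p2 (R : realType) (Q : groupoid) (G : groupType)
    (Q_lc : locally_compact [set: Q]) (Q_T2 : hausdorff_space Q)
    (Q_rd : r_discrete Q) (Q_sc : @second_countable Q)
    (c : Q -> G)
    (c_cont : continuous (c : Q -> discrete_topology G))
    (c_hom : groupoid_hom c)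
    (A : cstarAlgebra R) (iotaN : (kernel_groupoid c_hom -> R[i]^o) -> A)
    (CstarN : groupoid_Cstar iotaN)
    (B : cstarAlgebra R) (iotaQ : (Q -> R[i]^o) -> B)
    (CstarQ : groupoid_Cstar iotaQ) :
  exists2 i : A -> B, unique (canonical_map iotaN iotaQ) i & injective i.
Proof.
exists (canonical_extension Q_T2 Q_lc Q_rd c_cont CstarN CstarQ).
  split; first exact: canonical_extension_map.
  by move=> j; exact: canonical_map_unique.
exact: extension_inj.
Qed.
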